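(* Let $H\le G=\mathrm{PSL}_2(\mathbf Z[i])$ be torsion-free of finite index $n$. Then $$12\mid n,\qquad N:=|H\backslash G/K|=\frac n{12}.$$ There exists a Farey octahedral fundamental domain $P_T$ for $H$ consisting of exactly $N$ complete Farey octahedra. Every fundamental domain for $H$ that is a union of complete Farey octahedra contains exactly $N$ octahedra. One may choose $P_T$ so that the number of exposed triangular faces satisfies $$f_2^{\mathrm{exp}}(P_T)\le 6N+2 .$$ These exposed faces occur in distinct $H$-paired pairs, so the construction supplies at most $$3N+1=\frac n4+1$$ side-pairing transformations, and these transformations generate $H$.
   Context: $G=\mathrm{PSL}_2(\mathbf Z[i])$ acts on $\mathbf H^3$ by isometries extending Möbius transformations. $\mathcal O$ is the ideal octahedron with vertices $\infty,0,1,i,1+i,\tfrac{1+i}2$, and $K=\mathrm{Stab}_G(\mathcal O)$, a group of order $12$. The translates $g\mathcal O$ ($g\in G$) are the (complete) Gaussian Farey octahedra; they form a face-to-face tessellation of $\mathbf H^3$ with triangular faces. A *Farey octahedral fundamental domain* for $H\le G$ is a connected finite union of complete Gaussian Farey octahedra whose open octahedra represent the $H$-orbits of open Farey octahedra exactly once; equivalently its $H$-translates cover $\mathbf H^3$ and have disjoint interiors at the octahedral level. An *exposed* triangular face of such a union $P$ is a triangular face of one of its octahedra that is not shared by two octahedra of $P$; $f_2^{\mathrm{exp}}(P)$ is their number. If $F$ is an exposed face of $P$, the octahedron on the other side of $F$ is $hQ$ for an octahedron $Q$ of $P$ and some $h\in H$; then $h^{-1}F$ is an exposed face of $P$, and $h^{-1}$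 is the side-pairing transformation pairing $F$ with $h^{-1}F$ (a pair of paired faces contributes one transformation up to inversion). *)

(* Defs.v *)
From HB Require Import structures.
From mathcomp Require Import all_boot all_order all_algebra.
From mathcomp Require Import all_classical all_reals all_analysis.
From mathcomp Require Import complex ring.

Set Implicit Arguments.
Unset Strict Implicit.
Unset Printing Implicit Defensive.

Import Order.TTheory GRing.Theory Num.Theory.
Import numFieldNormedType.Exports.

Local Open Scope classical_set_scope.
Local Open Scope ring_scope.
Local Open Scope complex_scope.
Local Open Scope quotient_scope.
Local Open Scope card_scope.

(* The real-closed library makes [complex R] a ring only over a field, so Z[i]
   is an alias of [complex int] with that library's multiplication [mulc]. *)

Definition gauss : Type := complex int.

HB.instance Definition _ := GRing.Zmodule.copy gauss (complex int).

Fact gauss_mul1 : left_id (1 +i* 0 : gauss) (@ComplexField.mulc int).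
Proof. by move=> [a b] /=; rewrite !mul1r !mul0r subr0 addr0. Qed.

Fact gauss_mulDl :
  left_distributive (@ComplexField.mulc int) (+%R : gauss -> gauss -> gauss).
Proof.
by move=> [a b] [c d] [e f]; congr (_ +i* _) => /=; ring.
Qed.

Fact gauss_1neq0 : (1 +i* 0 : gauss) != 0.
Proof. by []. Qed.

HB.instance Definition _ := GRing.Zmodule_isComNzRing.Build gauss
  (@ComplexField.mulcA int) (@ComplexField.mulcC int)
  gauss_mul1 gauss_mulDl gauss_1neq0.

Record SL2Zi := MkSL2Zi { SL2val :> 'M[gauss]_2; _ : \det SL2val == 1 }.

HB.instance Definition _ := [isSub for SL2val].
HB.instance Definition _ := [Choice of SL2Zi by <:].

Lemma det_SL2 (A : SL2Zi) : \det A = 1.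
Proof. by apply/eqP; case: A. Qed.

Fact SL2_mul_subproof (A B : SL2Zi) : \det (SL2val A *m SL2val B) == 1.
Proof. by rewrite det_mulmx !det_SL2 mul1r. Qed.

Fact SL2_one_subproof : \det (1%:M : 'M[gauss]_2) == 1.
Proof. by rewrite det1. Qed.

Fact SL2_inv_subproof (A : SL2Zi) : \det (\adj A : 'M[gauss]_2) == 1.
Proof.
have /(congr1 determinant) := mul_mx_adj (SL2val A).
by rewrite det_mulmx det_SL2 mul1r det1 => ->.
Qed.

Definition SL2mul A B := MkSL2Zi (SL2_mul_subproof A B).
Definition SL2one := MkSL2Zi SL2_one_subproof.
Definition SL2inv A := MkSL2Zi (SL2_inv_subproof A).

Fact SL2_mulA : associative SL2mul.
Proof. by move=> A B C; apply/val_inj; rewrite /= mulmxA. Qed.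
Fact SL2_mul1 : left_id SL2one SL2mul.
Proof. by move=> A; apply/val_inj; rewrite /= mul1mx. Qed.
Fact SL2_mulr1 : right_id SL2one SL2mul.
Proof. by move=> A; apply/val_inj; rewrite /= mulmx1. Qed.
Fact SL2_mulV : left_inverse SL2one SL2inv SL2mul.
Proof. by move=> A; apply/val_inj; rewrite /= mul_adj_mx det_SL2. Qed.
Fact SL2_mulrV : right_inverse SL2one SL2inv SL2mul.
Proof. by move=> A; apply/val_inj; rewrite /= mul_mx_adj det_SL2. Qed.

HB.instance Definition _ :=
  isGroup.Build SL2Zi SL2_mulA SL2_mul1 SL2_mulr1 SL2_mulV SL2_mulrV.

Definition eq_sign : rel SL2Zi :=
  fun A B => (SL2val A == SL2val B) || (SL2val A == - SL2val B).

Fact eq_sign_refl : reflexive eq_sign.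
Proof. by move=> A; rewrite /eq_sign eqxx. Qed.
Fact eq_sign_sym : symmetric eq_sign.
Proof.
by move=> A B; rewrite /eq_sign [in RHS]eq_sym [in RHS](eq_sym (SL2val B)) eqr_oppLR.
Qed.
Fact eq_sign_trans : transitive eq_sign.
Proof.
move=> B A C /orP[] /eqP AB /orP[] /eqP BC; rewrite /eq_sign AB BC ?opprK eqxx //;
by rewrite orbT.
Qed.

Canonical eq_sign_equiv :=
  EquivRel eq_sign eq_sign_refl eq_sign_sym eq_sign_trans.

Definition PSL2Zi := {eq_quot eq_sign}.

HB.instance Definition _ := Choice.on PSL2Zi.
HB.instance Definition _ := EqQuotient.on PSL2Zi.

Definition PSL2mul (x y : PSL2Zi) : PSL2Zi := \pi_PSL2Zi (SL2mul (repr x) (repr y)).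
Definition PSL2inv (x : PSL2Zi) : PSL2Zi := \pi_PSL2Zi (SL2inv (repr x)).
Definition PSL2one : PSL2Zi := \pi_PSL2Zi SL2one.

Lemma repr_pi_sign (A : SL2Zi) : eq_sign (repr (\pi_PSL2Zi A)) A.
Proof. by apply/eqmodP; rewrite reprK. Qed.

Lemma PSL2_piM (A B : SL2Zi) :
  PSL2mul (\pi_PSL2Zi A) (\pi_PSL2Zi B) = \pi_PSL2Zi (SL2mul A B).
Proof.
apply/eqmodP; have := repr_pi_sign A; have := repr_pi_sign B.
rewrite /= /eq_sign /= => /orP[] /eqP -> /orP[] /eqP ->.
all: by rewrite ?mulmxN ?mulNmx ?opprK eqxx ?orbT.
Qed.

Fact SL2_invN (A B : SL2Zi) :
  SL2val A = - SL2val B -> SL2val (SL2inv A) = - SL2val (SL2inv B).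
Proof.
move=> AB.
have AV : SL2val (SL2inv A) *m SL2val A = 1%:M := congr1 SL2val (SL2_mulV A).
have BV : SL2val B *m SL2val (SL2inv B) = 1%:M := congr1 SL2val (SL2_mulrV B).
rewrite -[LHS]mulmx1 -BV mulmxA -[SL2val B]opprK -AB.
by rewrite mulmxN AV mulNmx mul1mx.
Qed.

Lemma PSL2_piV (A : SL2Zi) : PSL2inv (\pi_PSL2Zi A) = \pi_PSL2Zi (SL2inv A).
Proof.
apply/eqmodP; have := repr_pi_sign A; rewrite /= /eq_sign => /orP[] /eqP e.
  by rewrite (val_inj e) eqxx.
by rewrite (SL2_invN e) eqxx orbT.
Qed.

Fact PSL2_mulA : associative PSL2mul.
Proof.
move=> x y z; elim/quotW: x => A; elim/quotW: y => B; elim/quotW: z => C.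
by rewrite (PSL2_piM A B) (PSL2_piM B C) !PSL2_piM SL2_mulA.
Qed.
Fact PSL2_mul1 : left_id PSL2one PSL2mul.
Proof. by move=> x; elim/quotW: x => A; rewrite PSL2_piM SL2_mul1. Qed.
Fact PSL2_mulr1 : right_id PSL2one PSL2mul.
Proof. by move=> x; elim/quotW: x => A; rewrite PSL2_piM SL2_mulr1. Qed.
Fact PSL2_mulV : left_inverse PSL2one PSL2inv PSL2mul.
Proof. by move=> x; elim/quotW: x => A; rewrite PSL2_piV PSL2_piM SL2_mulV. Qed.
Fact PSL2_mulrV : right_inverse PSL2one PSL2inv PSL2mul.
Proof. by move=> x; elim/quotW: x => A; rewrite PSL2_piV PSL2_piM SL2_mulrV. Qed.

HB.instance Definition _ :=
  isGroup.Build PSL2Zi PSL2_mulA PSL2_mul1 PSL2_mulr1 PSL2_mulV PSL2_mulrV.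

Section Groups.
Local Open Scope group_scope.
Variable G : groupType.
Implicit Types H K S : set G.

Definition is_subgroup H :=
  [/\ H 1, (forall x y, H x -> H y -> H (x * y)) & forall x, H x -> H x^-1].

Definition torsion_free H := forall x k, H x -> (0 < k)%N -> x ^+ k = 1 -> x = 1.

Definition cosets H : set (set G) := [set [set h * x | h in H] | x in [set: G]].

Definition has_index H (n : nat) := cosets H #= `I_n.

Definition double_cosets H K : set (set G) :=
  [set [set y | exists h k, [/\ H h, K k & y = h * x * k]] | x in [set: G]].

Definition generated S : set G :=
  [set x | forall K, is_subgroup K -> S `<=` K -> K x].

End Groups.

Section HyperbolicSpace.
Variable R : realType.

(* The upper half-space {(x, y, t) | t > 0}, with (x, y) standing for the
   complex number x + iy, is an open subset of this ambient space, so that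
   [connected] and [interior] have their intrinsic meaning on subsets of it. *)
Definition ambient : Type := (R * R * R)%type.

HB.instance Definition _ := Topological.on ambient.

Definition zcoord (p : ambient) : R[i] := p.1.1 +i* p.1.2.
Definition height (p : ambient) : R := p.2.

Definition upper_half_space : set ambient := [set p | 0 < height p].

Definition sqnorm (w : R[i]) : R := complex.Re w ^+ 2 + complex.Im w ^+ 2.

Definition gaussC (w : gauss) : R[i] := (complex.Re w)%:~R +i* (complex.Im w)%:~R.

(* Poincare extension of z |-> (az + b) / (cz + d):
   (z, t) |-> (((az + b) (cz + d)^* + a c^* t^2) / D, t / D)
   with D = |cz + d|^2 + |c|^2 t^2. *)
Definition poincare (A : SL2Zi) (p : ambient) : ambient :=
  let a := gaussC (SL2val A 0 0) in let b := gaussC (SL2val A 0 1) in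
  let c := gaussC (SL2val A 1 0) in let d := gaussC (SL2val A 1 1) in
  let z := zcoord p in let t := height p in
  let D := sqnorm (c * z + d) + sqnorm c * t ^+ 2 in
  let w := (a * z + b) * conjc (c * z + d) + a * conjc c * (t ^+ 2)%:C in
  (complex.Re w / D, complex.Im w / D, t / D).

Definition act (g : PSL2Zi) : ambient -> ambient := poincare (repr g).

Lemma poincareN (A B : SL2Zi) :
  SL2val A = - SL2val B -> poincare A = poincare B.
Proof.
move=> AB; apply/funext => p; rewrite /poincare AB !mxE.
have gN w : gaussC (- w) = - gaussC w.
  by case: w => u v; congr (_ +i* _); rewrite /= mulrNz.
have sN w : sqnorm (- w) = sqnorm w by case: w => u v; rewrite /sqnorm /= !sqrrN.
have cN (w : R[i]) : conjc (- w) = - conjc w by case: w.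
by rewrite !gN !mulNr -!opprD !sN !cN !mulrN !mulNr !opprK.
Qed.

Lemma act_pi (A : SL2Zi) : act (\pi_PSL2Zi A) = poincare A.
Proof.
rewrite /act; have := repr_pi_sign A; rewrite /eq_sign => /orP[] /eqP e.
  by rewrite (val_inj e).
exact: poincareN.
Qed.

(* Points of the sphere at infinity: [Some z] for z in C, [None] for oo. *)
Definition ideal_point : Type := option R[i].

(* Every closed half-space of hyperbolic space is
   {al (|z|^2 + t^2) + 2 Re (be^* z) + ga >= 0} with al ga < |be|^2, the
   bounding plane being a hemisphere (al != 0) or a vertical plane (al = 0). *)
Record half_space := HalfSpace {
  hs_al : R; hs_be : R[i]; hs_ga : R;
  _ : hs_al * hs_ga < sqnorm hs_be }.

Definition in_half_space (M : half_space) (p : ambient) : Prop :=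
  0 <= hs_al M * (sqnorm (zcoord p) + height p ^+ 2)
       + 2 * complex.Re (conjc (hs_be M) * zcoord p) + hs_ga M.

(* Membership in the closure of the half-space at infinity. *)
Definition ideal_in_half_space (M : half_space) (v : ideal_point) : Prop :=
  match v with
  | Some z =>
      0 <= hs_al M * sqnorm z + 2 * complex.Re (conjc (hs_be M) * z) + hs_ga M
  | None => 0 <= hs_al M
  end.

(* Hyperbolic convex hull of a set of at least two ideal points. *)
Definition ideal_hull (V : set ideal_point) : set ambient :=
  [set p | upper_half_space p /\
     forall M, (forall v, V v -> ideal_in_half_space M v) -> in_half_space M p].

Definition apex : ideal_point := Some (2^-1 +i* 2^-1).

Definition octahedron : set ambient := ideal_hull
  [set` [:: None; Some 0; Some 1; Some (0 +i* 1); Some (1 +i* 1); apex] ].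

(* A face takes one vertex in each of the three pairs of opposite vertices. *)
Definition base_faces : set (set ambient) :=
  [set F | exists u v w, [/\ u \in [:: None; apex],
     v \in [:: Some 0; Some (1 +i* 1)], w \in [:: Some 1; Some (0 +i* 1)] &
     F = ideal_hull [set` [:: u; v; w]]] ].

Definition translate (g : PSL2Zi) (A : set ambient) : set ambient := act g @` A.

Definition stab_octahedron : set PSL2Zi :=
  [set g | translate g octahedron = octahedron].

Definition farey_octahedra : set (set ambient) :=
  [set translate g octahedron | g in [set: PSL2Zi]].

Definition faces (Q : set ambient) : set (set ambient) :=
  [set F | exists g F0, [/\ Q = translate g octahedron, base_faces F0 &
     F = translate g F0] ].

Section FundamentalDomain.
Variable H : set PSL2Zi.
(* A union of Farey octahedra is given by the set of these octahedra. *)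
Implicit Type P : set (set ambient).

Definition represents_orbits_once P :=
  P `<=` farey_octahedra /\
  forall Q, farey_octahedra Q ->
    exists! Q', P Q' /\ exists2 h, H h & interior Q = translate h (interior Q').

Definition farey_fundamental_domain P :=
  [/\ represents_orbits_once P, finite_set P & connected (\bigcup_(Q in P) Q)].

Definition shared_face P (F : set ambient) :=
  exists Q Q', [/\ P Q, P Q', Q <> Q', faces Q F & faces Q' F].

Definition exposed_faces P : set (set ambient) :=
  [set F | (exists2 Q, P Q & faces Q F) /\ ~ shared_face P F].

(* The octahedron on the other side of F is the translate by h of some
   octahedron Q of P; the side-pairing transformation is s = h^-1. *)
Definition side_pairing P (F : set ambient) (s : PSL2Zi) :=
  exposed_faces P F /\
  exists h Q0 Q, [/\ H h, P Q0 /\ faces Q0 F,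
    P Q /\ faces (translate h Q) F, translate h Q <> Q0 & s = (h^-1)%g].

Definition side_pairings P : set PSL2Zi :=
  [set s | exists F, side_pairing P F s].

Definition face_pairs P : set (set (set ambient)) :=
  [set E | exists F s, side_pairing P F s /\ E = [set F; translate s F] ].

End FundamentalDomain.
End HyperbolicSpace.

Arguments octahedron R _ : clear implicits.
Arguments stab_octahedron R _ : clear implicits.

(* Main.v *)
From HB Require Import structures.
Require Import Defs.
From mathcomp Require Import all_boot all_order all_algebra.
From mathcomp Require Import all_classical all_reals all_analysis.
From mathcomp Require Import complex finmap ring lra zify.

(** The geometry is turned into arithmetic of integral hermitian forms.  A point
    (z, t) of hyperbolic space is the positive ray of the hermitian matrix with
    rows (|z|^2 + t^2, z) and (conj z, 1); SL2(Z[i]) acts linearly on hermitian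
    matrices and preserves their determinant, a Lorentz form.  In suitable
    linear coordinates s, p, q, r twice this determinant is s^2 - p^2 - q^2 - r^2
    and the cone over the octahedron O is |p| + |q| + |r| <= s: its axis is an
    integral form C ([ocenter]), its walls are the orthogonals of the eight
    integral vectors (1, +-1, +-1, +-1) ([normal]).

    Three facts about integral vectors carry the tessellation.

    - A translate gC that lies in the cone of O is C itself ([ocenter_rigid],
      where the parity of gC matters).  Hence gO = hO iff gC = hC, and tiles with
      the same interior coincide.
    - If gO and O share a face then gC is C or the center on the other side of
      that face ([face_match]): g carries the norm 2 vectors in the middle
      of the edges to one another, and these determine gC up to the side.  For every
      face, an explicit involution of G exchanges the two sides ([crossing]).  So
      a face belongs to exactly two tiles ([neighbourP]).
    - If gC is outside the cone of O, crossing a violated wall of O lowers the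
      positive integer (gC, C).  So all tiles are reached from O through faces
      ([tile_ind]), without any recourse to the Euclidean algorithm.

    The stabilizer K of C consists of 12 elements, found by bounding the entries
    of its matrices, so its elements are torsion and H acts freely on tiles.
    Each double coset HxK is then made of 12 cosets of H, and the H-orbits of
    tiles correspond to the double cosets ([card_double_cosets],
    [orbit_reps_card]).

    The domain grows from O: while some orbit is missing, a missing tile is
    adjacent to the current union, up to H ([covers_or_boundary]).  Gluing it
    removes one exposed face and adds at most seven, so k tiles have at most
    6k + 2 exposed faces ([grow]).  An exposed face and its partner are exchanged
    by the side pairing, which has no fixed face because H is torsion free; this
    halves the count.  Finally a subgroup L of H that contains the side pairings
    is H: the tiles in the L-orbits of the domain are closed under adjacency
    ([side_pairings_generate]). *)

Set Implicit Arguments.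
Unset Strict Implicit.
Unset Printing Implicit Defensive.

Import Order.TTheory GRing.Theory Num.Theory.
Import numFieldNormedType.Exports.

Local Open Scope classical_set_scope.
Local Open Scope ring_scope.
Local Open Scope quotient_scope.
Local Open Scope card_scope.

(** * Binary hermitian forms and the action of SL2(Z[i]) *)

(** The hermitian matrix with rows (hal, hx + i hy) and (hx - i hy, hde). *)
Record herm (T : Type) := Herm { hal : T; hx : T; hy : T; hde : T }.

Definition hmap S T (f : S -> T) (v : herm S) : herm T :=
  Herm (f (hal v)) (f (hx v)) (f (hy v)) (f (hde v)).

Lemma mulmx2E (S : pzSemiRingType) m n (A : 'M[S]_(m, 2)) (B : 'M[S]_(2, n)) i j :
  (A *m B) i j = A i 0 * B 0 j + A i 1 * B 1 j.
Proof. by rewrite mxE big_ord_recl big_ord1; congr (_ + A i _ * B _ j); apply/val_inj. Qed.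

Lemma det_mx22 (S : comNzRingType) (A : 'M[S]_2) :
  \det A = A 0 0 * A 1 1 - A 0 1 * A 1 0.
Proof.
rewrite (expand_det_row _ 0) big_ord_recl big_ord1 /cofactor !det_mx11 !mxE.
rewrite expr0 expr1 mul1r mulN1r mulrN.
by congr (A _ _ * A _ _ - A _ _ * A _ _); apply/val_inj.
Qed.

Section HermitianForms.
Variable T : comNzRingType.
Implicit Types (u v w : herm T) (A B : SL2Zi).

Definition hadd u v :=
  Herm (hal u + hal v) (hx u + hx v) (hy u + hy v) (hde u + hde v).
Definition hscale k v := Herm (k * hal v) (k * hx v) (k * hy v) (k * hde v).

(** The polarization of twice the determinant. *)
Definition hdot u v :=
  hal u * hde v + hde u * hal v - 2 * hx u * hx v - 2 * hy u * hy v.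

(** The product A X A^H, where A has rows (a + i a', b + i b') and
    (c + i c', d + i d').  The entries are kept as separate scalars so that
    [ring] proves all identities, over the integers as over the reals. *)
Definition hact8 (a a' b b' c c' d d' : T) v := Herm
  ((a ^+ 2 + a' ^+ 2) * hal v
    + 2 * ((a * b + a' * b') * hx v + (a * b' - a' * b) * hy v)
    + (b ^+ 2 + b' ^+ 2) * hde v)
  ((a * c + a' * c') * hal v
    + (a * d + a' * d' + b * c + b' * c') * hx v
    + (a * d' - a' * d + b' * c - b * c') * hy v
    + (b * d + b' * d') * hde v)
  ((a' * c - a * c') * hal v
    + (a' * d - a * d' + b' * c - b * c') * hx v
    + (a * d + a' * d' - b * c - b' * c') * hy v
    + (b' * d - b * d') * hde v)
  ((c ^+ 2 + c' ^+ 2) * hal v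
    + 2 * ((c * d + c' * d') * hx v + (c * d' - c' * d) * hy v)
    + (d ^+ 2 + d' ^+ 2) * hde v).

Definition reT A i j : T := (complex.Re (SL2val A i j))%:~R.
Definition imT A i j : T := (complex.Im (SL2val A i j))%:~R.

Definition hact A v :=
  hact8 (reT A 0 0) (imT A 0 0) (reT A 0 1) (imT A 0 1)
        (reT A 1 0) (imT A 1 0) (reT A 1 1) (imT A 1 1) v.

Lemma reT_mul A B i j : reT (SL2mul A B) i j =
  reT A i 0 * reT B 0 j - imT A i 0 * imT B 0 j
  + (reT A i 1 * reT B 1 j - imT A i 1 * imT B 1 j).
Proof.
rewrite /reT /imT /= mulmx2E -!rmorphM -!rmorphB -rmorphD; congr (_%:~R).
by case: (SL2val A i 0) (SL2val B 0 j) (SL2val A i 1) (SL2val B 1 j) => ??[??][??][??].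
Qed.

Lemma imT_mul A B i j : imT (SL2mul A B) i j =
  reT A i 0 * imT B 0 j + imT A i 0 * reT B 0 j
  + (reT A i 1 * imT B 1 j + imT A i 1 * reT B 1 j).
Proof.
rewrite /reT /imT /= mulmx2E -!rmorphM -!rmorphD; congr (_%:~R).
by case: (SL2val A i 0) (SL2val B 0 j) (SL2val A i 1) (SL2val B 1 j) => ??[??][??][??].
Qed.

Lemma hact8M (a a' b b' c c' d d' e e' f f' g g' h h' : T) v :
  hact8 a a' b b' c c' d d' (hact8 e e' f f' g g' h h' v) =
  hact8 (a*e - a'*e' + (b*g - b'*g')) (a*e' + a'*e + (b*g' + b'*g))
    (a*f - a'*f' + (b*h - b'*h')) (a*f' + a'*f + (b*h' + b'*h))
    (c*e - c'*e' + (d*g - d'*g')) (c*e' + c'*e + (d*g' + d'*g))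
    (c*f - c'*f' + (d*h - d'*h')) (c*f' + c'*f + (d*h' + d'*h)) v.
Proof. by case: v => ????; rewrite /hact8 /=; congr Herm; ring. Qed.

Lemma hactM A B v : hact (SL2mul A B) v = hact A (hact B v).
Proof. by rewrite /hact hact8M !reT_mul !imT_mul. Qed.

Lemma hact1 v : hact SL2one v = v.
Proof.
rewrite /hact /reT /imT /= !mxE /=; case: v => ????.
by rewrite /hact8 /=; congr Herm; ring.
Qed.

Lemma hact_sign A B v : eq_sign A B -> hact A v = hact B v.
Proof.
case/orP => /eqP e; rewrite /hact /reT /imT e //.
have reN (z : gauss) : complex.Re (- z) = - complex.Re z by case: z.
have imN (z : gauss) : complex.Im (- z) = - complex.Im z by case: z.
by rewrite !mxE !reN !imN !rmorphN /= /hact8; congr Herm; ring.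
Qed.

Lemma det_entries A :
  (reT A 0 0 * reT A 1 1 - imT A 0 0 * imT A 1 1
   - (reT A 0 1 * reT A 1 0 - imT A 0 1 * imT A 1 0) = 1) /\
  (reT A 0 0 * imT A 1 1 + imT A 0 0 * reT A 1 1
   - (reT A 0 1 * imT A 1 0 + imT A 0 1 * reT A 1 0) = 0).
Proof.
have := det_SL2 A; rewrite det_mx22 /reT /imT.
case: (SL2val A 0 0) (SL2val A 0 1) (SL2val A 1 0) (SL2val A 1 1) =>
  a a' [b b'] [c c'] [d d'] [e1 e2] /=.
rewrite -!rmorphM -!rmorphB -!rmorphD -!rmorphB.
by split; [rewrite -[1]/(1%:~R) -e1|rewrite -[0]/(0%:~R) -e2].
Qed.

Lemma hact_dot A u v : hdot (hact A u) (hact A v) = hdot u v.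
Proof.
have [e1 e2] := det_entries A.
transitivity ((1 ^+ 2 + 0 ^+ 2) * hdot u v); last by ring.
by rewrite -e1 -e2 /hdot /hact /hact8 /=; ring.
Qed.

Lemma hactZ A k v : hact A (hscale k v) = hscale k (hact A v).
Proof. by rewrite /hact /hact8 /hscale /=; congr Herm; ring. Qed.

Lemma hdotC u v : hdot u v = hdot v u.
Proof. by rewrite /hdot; ring. Qed.
Lemma hdotDl u v w : hdot (hadd u v) w = hdot u w + hdot v w.
Proof. by rewrite /hdot /hadd /=; ring. Qed.
Lemma hdotZl k u v : hdot (hscale k u) v = k * hdot u v.
Proof. by rewrite /hdot /hscale /=; ring. Qed.

(** With [lp], [lq] and [lr] below, coordinates that diagonalize [hdot]
    ([hdot_lor]) and in which the six vertices of the octahedron are, up to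
    scale, (1, +-1, 0, 0), (1, 0, +-1, 0) and (1, 0, 0, +-1). *)
Definition ls v := hal v + hde v - hx v - hy v.
Definition lp v := hal v - hx v - hy v.
Definition lq v := hde v - hx v - hy v.
Definition lr v := hx v - hy v.

Lemma hdot_lor u v :
  hdot u v = ls u * ls v - lp u * lp v - lq u * lq v - lr u * lr v.
Proof. by rewrite /hdot /ls /lp /lq /lr; ring. Qed.

End HermitianForms.

Lemma hact_hmap (T : comNzRingType) A (v : herm int) :
  hact A (hmap (intr : int -> T) v) = hmap intr (hact A v).
Proof.
rewrite /hact /hmap /hact8 /reT /imT /= !intz.
by congr Herm; ring.
Qed.

Lemma hdot_hmap (T : comNzRingType) (u v : herm int) :
  hdot (hmap (intr : int -> T) u) (hmap intr v) = (hdot u v)%:~R.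
Proof. by rewrite /hdot /hmap /=; ring. Qed.

(** Well defined on PSL2 because the action is quadratic in the matrix
    entries: a sign disappears ([hact_sign]). *)
Definition gact (T : comNzRingType) (g : PSL2Zi) (v : herm T) := hact (repr g) v.

Section PSLAction.
Variable T : comNzRingType.
Implicit Types (u v w : herm T) (g h : PSL2Zi).

Lemma gact_pi A v : gact (\pi_PSL2Zi A) v = hact A v.
Proof. exact/hact_sign/repr_pi_sign. Qed.

Lemma gactM g h v : gact (g * h)%g v = gact g (gact h v).
Proof.
by elim/quotW: g => A; elim/quotW: h => B; rewrite [(_ * _)%g]PSL2_piM !gact_pi hactM.
Qed.

Lemma gact1 v : gact 1%g v = v.
Proof. by rewrite gact_pi hact1. Qed.

Lemma gactK g v : gact g^-1%g (gact g v) = v.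
Proof. by rewrite -gactM mulVg gact1. Qed.
Lemma gactVK g v : gact g (gact g^-1%g v) = v.
Proof. by rewrite -gactM mulgV gact1. Qed.

Lemma gact_dot g u v : hdot (gact g u) (gact g v) = hdot u v.
Proof. exact: hact_dot. Qed.

Lemma gact_dotV g u v : hdot (gact g u) v = hdot u (gact g^-1%g v).
Proof. by rewrite -(gact_dot g u) gactVK. Qed.

Lemma gactZ g k v : gact g (hscale k v) = hscale k (gact g v).
Proof. exact: hactZ. Qed.
End PSLAction.

Lemma gact_hmap (T : comNzRingType) g (v : herm int) :
  gact g (hmap (intr : int -> T) v) = hmap intr (gact g v).
Proof. exact: hact_hmap. Qed.

(** * Integral vectors around the octahedral cone *)

Definition face_index : finType := (bool * bool * bool)%type.

(** The vector (2, 0, 0, 0) in the coordinates s, p, q, r; it is the common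
    sum of each of the three pairs of opposite vertices. *)
Definition ocenter : herm int := Herm 2 1 1 2.

(** The two primitive null vectors over oo and (1 + i) / 2, which are opposite
    vertices; [vtx2] and [vtx3] are the pairs 0, 1 + i and 1, i.  A face selects
    one vertex in each pair, hence its three booleans. *)
Definition vtx1 (b : bool) : herm int := if b then Herm 1 1 1 2 else Herm 1 0 0 0.
Definition vtx2 (b : bool) : herm int := if b then Herm 2 1 1 1 else Herm 0 0 0 1.
Definition vtx3 (b : bool) : herm int := if b then Herm 1 0 1 1 else Herm 1 1 0 1.

(** The vector with s = 1 and p, q, r = +-1, the sign being minus for [true]. *)
Definition normal (b : face_index) : herm int :=
  let: (b1, b2, b3) := b in
  Herm (2 * b2%:Z) (b1%:Z + b2%:Z - b3%:Z) (b1%:Z + b2%:Z + b3%:Z - 1) (2 * b1%:Z).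

(** The sum of two vertices of a face is a point of hyperbolic space on the edge
    that joins them, unlike the vertices themselves. *)
Definition edge12 (b : face_index) := hadd (vtx1 b.1.1) (vtx2 b.1.2).
Definition edge13 (b : face_index) := hadd (vtx1 b.1.1) (vtx3 b.2).
Definition edge23 (b : face_index) := hadd (vtx2 b.1.2) (vtx3 b.2).

Definition in_oct (T : numDomainType) (v : herm T) :=
  forall b, 0 <= hdot v (hmap intr (normal b)).

Definition in_face (T : numDomainType) b (v : herm T) :=
  in_oct v /\ hdot v (hmap intr (normal b)) = 0.

Lemma hmap_int (v : herm int) : hmap intr v = v.
Proof. by case: v => ????; rewrite /hmap /= !intz. Qed.

Lemma hdot_normal (T : comNzRingType) (v : herm T) b :
  hdot v (hmap intr (normal b)) =
  ls v - (-1) ^+ b.1.1 * lp v - (-1) ^+ b.1.2 * lq v - (-1) ^+ b.2 * lr v.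
Proof.
by case: b => [[[] []] []]; rewrite /hdot /hmap /ls /lp /lq /lr /=; ring.
Qed.

Lemma in_octE (T : realDomainType) (v : herm T) :
  in_oct v <-> `|lp v| + `|lq v| + `|lr v| <= ls v.
Proof.
split => [h|h b].
  pose b : face_index := (lp v < 0, lq v < 0, lr v < 0).
  by have := h b; rewrite hdot_normal /= -!normrEsign; lra.
rewrite hdot_normal.
have nb (c : bool) (x : T) : (-1) ^+ c * x <= `|x|.
  by apply: le_trans (ler_norm _) _; rewrite normrM normr_sign mul1r.
have := nb b.1.1 (lp v); have := nb b.1.2 (lq v); have := nb b.2 (lr v); lra.
Qed.
Lemma herm_lor_inj (u v : herm int) :
  ls u = ls v -> lp u = lp v -> lq u = lq v -> lr u = lr v -> u = v.
Proof.
case: u v => a x y d [a' x' y' d']; rewrite /ls /lp /lq /lr /= => *.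
by congr Herm; lia.
Qed.

(** The forms which take even values and whose off-diagonal coefficient lies in
    the ideal (1 + i).  This sublattice is invariant and contains [ocenter]; in
    the coordinates s, p, q, r it amounts to all four being even. *)
Definition heven (v : herm int) :=
  exists a d u, [/\ hal v = 2 * a, hde v = 2 * d & hx v = hy v + 2 * u].

Lemma heven_hact A (v : herm int) : heven v -> heven (hact A v).
Proof.
case: v => al x y de [a0 [d0 [u0 /= [-> -> ->]]]]; rewrite /hact /hact8 /=.
move: (reT int A 0 0) (imT int A 0 0) (reT int A 0 1) (imT int A 0 1)
      (reT int A 1 0) (imT int A 1 0) (reT int A 1 1) (imT int A 1 1)
  => a a' b b' c c' d d'.
exists ((a ^+ 2 + a' ^+ 2) * a0
    + ((a * b + a' * b') * (y + 2 * u0) + (a * b' - a' * b) * y)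
    + (b ^+ 2 + b' ^+ 2) * d0).
exists ((c ^+ 2 + c' ^+ 2) * a0
    + ((c * d + c' * d') * (y + 2 * u0) + (c * d' - c' * d) * y)
    + (d ^+ 2 + d' ^+ 2) * d0).
exists ((a * c + a' * c' - a' * c + a * c') * a0
    + (a * d + a' * d' + b * c + b' * c' - a' * d + a * d' - b' * c + b * c') * u0
    + (b * c + b' * c' - a' * d + a * d') * y
    + (b * d + b' * d' - b' * d + b * d') * d0).
by split => /=; ring.
Qed.

Lemma heven_ocenter : heven ocenter. Proof. by exists 1, 1, 0. Qed.

(** Halving the coordinates gives integers with s^2 = 1 + p^2 + q^2 + r^2 and
    |p| + |q| + |r| <= s, whence 2 (|pq| + |pr| + |qr|) <= 1 and p = q = r = 0.
    Evenness is essential: the form with s, p, q, r = 3, 2, 1, 0 satisfies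
    the two other hypotheses. *)
Lemma ocenter_rigid (v : herm int) :
  heven v -> hdot v v = 4 -> in_oct v -> v = ocenter.
Proof.
move=> [a [d [u [ea ed eu]]]] nv /in_octE.
have -> : lp v = 2 * (a - hy v - u) by rewrite /lp ea eu; ring.
have -> : lq v = 2 * (d - hy v - u) by rewrite /lq ed eu; ring.
have -> : lr v = 2 * u by rewrite /lr eu; ring.
have -> : ls v = 2 * (a + d - hy v - u) by rewrite /ls ea ed eu; ring.
rewrite !normrM (ger0_norm (isT : (0 : int) <= 2)) => hs.
have nv' : (a + d - hy v - u) ^+ 2 = 1 + `|a - hy v - u| ^+ 2
    + `|d - hy v - u| ^+ 2 + `|u| ^+ 2.
  rewrite !real_normK ?num_real //; move: nv; rewrite /hdot ea ed eu; lra.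
(* It suffices that the three halved coordinates vanish. *)
have [] : [/\ `|a - hy v - u| = 0, `|d - hy v - u| = 0 & `|u| = 0]; last first.
  move=> e1 e2 e3; rewrite e1 e2 e3 in hs nv'.
  move: e1 e2 e3 => /normr0_eq0 e1 /normr0_eq0 e2 /normr0_eq0 e3.
  have eay : a = hy v by lia.
  have edy : d = hy v by lia.
  rewrite eay edy e3 in ea ed eu hs nv'.
  have y1 : hy v = 1 by nia.
  by case: v {nv hs nv' e1 e2 eay edy} y1 ea ed eu => al x y de /= -> -> -> ->.
move: hs nv' (normr_ge0 (a - hy v - u)) (normr_ge0 (d - hy v - u)) (normr_ge0 u).
move: `|_| `|_| `|_| (a + d - hy v - u) => p q r s hs nv' p0 q0 r0.
have [pq pr qr] : [/\ p * q = 0, p * r = 0 & q * r = 0].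
  have small (x y z : int) : 0 <= x -> 0 <= y -> 0 <= z -> 2 * (x + y + z) <= 1 ->
    [/\ x = 0, y = 0 & z = 0] by clear; move=> *; split; lia.
  have le_s : (p + q + r) ^+ 2 <= s ^+ 2 by rewrite ler_sqr ?nnegrE; lia.
  by apply: small; rewrite ?mulr_ge0 //; lra.
have sq (x y : int) : 0 <= x -> 0 <= y -> x ^+ 2 = 1 + y ^+ 2 -> y = 0.
  clear=> x0 y0 xy; have yx : y < x by rewrite -ltr_sqr ?nnegrE // xy; lra.
  have : 0 <= (x - y - 1) * (x + y + 1) by apply: mulr_ge0; lia.
  by move=> ?; lra.
have s0 : 0 <= s by move: hs p0 q0 r0; clear; lia.
move/eqP: pq; rewrite mulf_eq0 => /orP[] /eqP z; move: pr qr nv' hs; rewrite z.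
  move=> _ /eqP; rewrite mulf_eq0 => /orP[] /eqP -> nv' _; split=> //.
    by apply: (sq s) => //; lra.
  by apply: (sq s) => //; lra.
move=> /eqP; rewrite mulf_eq0 => /orP[] /eqP -> _ nv' _; split=> //.
  by apply: (sq s) => //; lra.
by apply: (sq s) => //; lra.
Qed.

(** Here s = 1 and p^2 + q^2 + r^2 = 3. *)
Lemma facet_normalP (v : herm int) :
  hdot v ocenter = 2 -> hdot v v = - 2 -> exists b, v = normal b.
Proof.
have -> : hdot v ocenter = 2 * ls v by rewrite /hdot /ls /=; ring.
move=> s2; have s1 : ls v = 1 by lia.
rewrite hdot_lor s1 => nv.
have sq1 (x : int) : x ^+ 2 <= 3 -> x = - 1 \/ x = 0 \/ x = 1 by move=> *; nia.
have lelr : lp v ^+ 2 + lq v ^+ 2 + lr v ^+ 2 = 3 by lia.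
have p2 := sqr_ge0 (lp v); have q2 := sqr_ge0 (lq v); have r2 := sqr_ge0 (lr v).
have [] : [/\ lp v ^+ 2 <= 3, lq v ^+ 2 <= 3 & lr v ^+ 2 <= 3].
  by split; lra.
move=> /sq1 hp /sq1 hq /sq1 hr; clear sq1 p2 q2 r2 nv.
exists (lp v < 0, lq v < 0, lr v < 0).
case: hp lelr => [|[|]] p1; case: hq => [|[|]] q1; case: hr => [|[|]] r1;
  rewrite p1 q1 r1 // => _;
  by apply: herm_lor_inj; rewrite ?s1 ?p1 ?q1 ?r1.
Qed.

(** On the face, the coordinates a, b, c = |p|, |q|, |r| satisfy s = a + b + c, so
    that the norm condition reads ab + ac + bc = 1. *)
Lemma edgeP b (v : herm int) : in_face b v -> hdot v v = 2 ->
  [\/ v = edge12 b, v = edge13 b | v = edge23 b].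
Proof.
case=> vo; rewrite hdot_normal => fv nv.
pose p := (-1) ^+ b.1.1 * lp v; pose q := (-1) ^+ b.1.2 * lq v; pose r := (-1) ^+ b.2 * lr v.
have p0 : 0 <= p.
  have := vo (~~ b.1.1, b.1.2, b.2); rewrite hdot_normal /= /p signrN; lra.
have q0 : 0 <= q.
  have := vo (b.1.1, ~~ b.1.2, b.2); rewrite hdot_normal /= /q signrN; lra.
have r0 : 0 <= r.
  have := vo (b.1.1, b.1.2, ~~ b.2); rewrite hdot_normal /= /r signrN; lra.
have sE : ls v = p + q + r by rewrite /p /q /r; lra.
have pE : lp v = (-1) ^+ b.1.1 * p by rewrite /p signrMK.
have qE : lq v = (-1) ^+ b.1.2 * q by rewrite /q signrMK.
have rE : lr v = (-1) ^+ b.2 * r by rewrite /r signrMK.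
clearbody p q r.
have e1 : p * q + p * r + q * r = 1.
  move: nv; rewrite hdot_lor sE pE qE rE -!expr2 !exprMn !sqrr_sign; lra.
have : [\/ p = 1 /\ q = 1 /\ r = 0, p = 1 /\ q = 0 /\ r = 1 | p = 0 /\ q = 1 /\ r = 1].
  have pq : 0 <= p * q by nia.
  have pr : 0 <= p * r by nia.
  have qr : 0 <= q * r by nia.
  have one (x y : int) : 0 <= x -> 0 <= y -> x * y = 1 -> x = 1 /\ y = 1.
    case: x y => [m|//] [k|//] _ _ /eqP; rewrite -PoszM eqz_nat muln_eq1.
    by case/andP => /eqP -> /eqP ->.
  have [h|[h|h]] : p * q = 1 \/ p * r = 1 \/ q * r = 1.
    by move: e1 pq pr qr; clear; lia.
  - by have [ep eq] := one _ _ p0 q0 h; apply: Or31; rewrite ep eq in e1 *; lia.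
  - by have [ep er] := one _ _ p0 r0 h; apply: Or32; rewrite ep er in e1 *; lia.
  - by have [eq er] := one _ _ q0 r0 h; apply: Or33; rewrite eq er in e1 *; lia.
case: b {vo fv} p q r p0 q0 r0 sE pE qE rE e1 => [[b1 b2] b3] /= p q r _ _ _ sE pE qE rE _.
move=> [] [ep [eq er]]; [apply: Or31|apply: Or32|apply: Or33];
  apply: herm_lor_inj; rewrite ?sE ?pE ?qE ?rE ?ep ?eq ?er;
  by clear; case: b1; case: b2; case: b3.
Qed.

(** The three products with the edges force |p|, |q|, |r| to be |s - 2|, with the
    signs of the face; the norm leaves s = 2 or s = 4, one center on each side. *)
Lemma face_centerP b (v : herm int) : hdot v v = 4 ->
  hdot v (edge12 b) = 4 -> hdot v (edge13 b) = 4 -> hdot v (edge23 b) = 4 ->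
  v = ocenter \/ v = hadd ocenter (hscale 2 (normal b)).
Proof.
move=> nv; rewrite ![hdot _ (edge12 _)]hdot_lor ![hdot _ (edge13 _)]hdot_lor.
rewrite ![hdot _ (edge23 _)]hdot_lor => h1 h2 h3.
have [pE qE rE] : [/\ lp v = (-1) ^+ b.1.1 * (ls v - 2),
   lq v = (-1) ^+ b.1.2 * (ls v - 2) & lr v = (-1) ^+ b.2 * (ls v - 2)].
  move: h1 h2 h3; case: b => [[[] []] []]; rewrite /ls /lp /lq /lr /= => *; split; lra.
have /eqP : (ls v - 2) * (ls v - 4) = 0.
  by move: nv; rewrite hdot_lor pE qE rE -!expr2 !exprMn !sqrr_sign; lra.
rewrite mulf_eq0 !subr_eq0 => /orP[] /eqP e; [left|right];
  apply: herm_lor_inj; rewrite ?pE ?qE ?rE e //;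
 by case: b {h1 h2 h3 pE qE rE} => [[[] []] []].
Qed.

(** * Hyperbolic space as the cone of positive forms *)

Definition hpos (T : realDomainType) (v : herm T) := 0 < hde v /\ 0 < hdot v v.

(** Completing the square: [hde v * hde (A v)] is a sum of squares plus
    |c|^2 times the determinant of v, and (c, d) is not zero. *)
Lemma hact_pos (T : realDomainType) A (v : herm T) : hpos v -> hpos (hact A v).
Proof.
move=> [d0 n0]; split; last by rewrite hact_dot.
have [e1 e2] := det_entries T A.
rewrite -(pmulr_rgt0 _ d0).
set c := reT T A 1 0 in e1 e2 *; set c' := imT T A 1 0 in e1 e2 *.
set d := reT T A 1 1 in e1 e2 *; set d' := imT T A 1 1 in e1 e2 *.
have -> : hde v * hde (hact A v) =
  (c * hx v - c' * hy v + d * hde v) ^+ 2 + (c' * hx v + c * hy v + d' * hde v) ^+ 2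
  + (c ^+ 2 + c' ^+ 2) * (hal v * hde v - hx v ^+ 2 - hy v ^+ 2).
  by rewrite /hact /= -/c -/c' -/d -/d'; ring.
have n1 : 0 < hal v * hde v - hx v ^+ 2 - hy v ^+ 2.
  by move: n0; rewrite /hdot; lra.
have := mulr_ge0 (addr_ge0 (sqr_ge0 c) (sqr_ge0 c')) (ltW n1).
rewrite lt_neqAle => m0; rewrite !addr_ge0 ?sqr_ge0 // andbT; apply/eqP => z.
have := sqr_ge0 (c * hx v - c' * hy v + d * hde v).
have := sqr_ge0 (c' * hx v + c * hy v + d' * hde v) => s1 s2.
have /eqP : (c ^+ 2 + c' ^+ 2) * (hal v * hde v - hx v ^+ 2 - hy v ^+ 2) = 0 by lra.
rewrite mulf_eq0 (gt_eqF n1) orbF paddr_eq0 ?sqr_ge0 // !sqrf_eq0.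
case/andP => /eqP c0 /eqP c'0; move: z e1 e2; rewrite c0 c'0.
rewrite !(mul0r, mulr0, subr0, sub0r, add0r, addr0, oppr0, expr0n) /=.
move/esym/eqP; rewrite paddr_eq0 ?sqr_ge0 // !sqrf_eq0 !mulf_eq0 !(gt_eqF d0) !orbF.
case/andP => /eqP -> /eqP ->; rewrite !mulr0 subr0 => /eqP.
by rewrite eq_sym oner_eq0.
Qed.

Section Points.
Variable R : realType.
Local Notation ambient := (ambient R).
Local Notation uhs := (@upper_half_space R).
Implicit Types (p : ambient) (v : herm R).

(** The form which represents a point; positive forms are exactly its positive
    multiples ([emb_pos], [emb_surj]). *)
Definition emb p : herm R :=
  Herm (p.1.1 ^+ 2 + p.1.2 ^+ 2 + p.2 ^+ 2) p.1.1 p.1.2 1.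

Lemma hdot_emb p : hdot (emb p) (emb p) = 2 * p.2 ^+ 2.
Proof. by rewrite /hdot /=; ring. Qed.

Lemma emb_pos p : uhs p -> hpos (emb p).
Proof. by move=> t0; split; rewrite ?hdot_emb //= ?ltr01 // mulr_gt0 ?exprn_gt0. Qed.

Lemma emb_inj p p' k : uhs p -> uhs p' -> emb p = hscale k (emb p') -> p = p'.
Proof.
case: p p' => [[x y] t] [[x' y'] t']; rewrite /upper_half_space /height /= => t0 t0'.
rewrite /emb /hscale /= => -[e1 e2 e3]; rewrite mulr1 => k1.
move: e1 e2 e3; rewrite -k1 !mul1r => e1 e2 e3; move: e1; rewrite e2 e3 => /addrI.
by move=> /eqP; rewrite eqrXn2 ?ltW // => /eqP ->.
Qed.

Lemma emb_surj v : hpos v -> exists2 p, uhs p & v = hscale (hde v) (emb p).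
Proof.
move=> [d0 n0].
pose t := Num.sqrt (hal v * hde v - hx v ^+ 2 - hy v ^+ 2) / hde v.
have n1 : 0 < hal v * hde v - hx v ^+ 2 - hy v ^+ 2 by move: n0; rewrite /hdot; lra.
exists ((hx v / hde v, hy v / hde v, t) : ambient).
  by rewrite /upper_half_space /height /= divr_gt0 // sqrtr_gt0.
have dn0 : hde v != 0 by rewrite gt_eqF.
case: v d0 n0 @t n1 dn0 => al x y de /= d0 n0 n1 dn0.
rewrite /hscale /= !expr_div_n sqr_sqrtr ?ltW //; congr Herm; by field.
Qed.

Lemma hdeZ k v : hde (hscale k v) = k * hde v. Proof. by []. Qed.

(** The denominator of the Poincare extension is the last entry of the
    transformed form; this is why the extension is projectively linear. *)
Lemma poincare_denom A p :
  sqnorm (gaussC R (SL2val A 1 0) * zcoord p + gaussC R (SL2val A 1 1)) +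
  sqnorm (gaussC R (SL2val A 1 0)) * height p ^+ 2 = hde (hact A (emb p)).
Proof.
case: p => [[x y] t]; rewrite /hact /reT /imT /=.
case: (SL2val A 1 0) (SL2val A 1 1) => c c' [d d'].
by rewrite /sqnorm /gaussC /zcoord /height /=; ring.
Qed.

Lemma poincare_coords A p : let v := hact A (emb p) in
  poincare A p = (hx v / hde v, hy v / hde v, p.2 / hde v).
Proof.
rewrite /poincare poincare_denom; set w := (_ * conjc _ + _).
have [-> ->] // : complex.Re w = hx (hact A (emb p)) /\ complex.Im w = hy (hact A (emb p)).
rewrite /w; case: (p) => [[x y] t]; rewrite /hact /reT /imT /=.
case: (SL2val A 0 0) (SL2val A 0 1) (SL2val A 1 0) (SL2val A 1 1)
  => a a' [b b'] [c c'] [d d'].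
by rewrite /gaussC /zcoord /height /=; split; ring.
Qed.

Lemma poincareE A p : uhs p ->
  hact A (emb p) = hscale (hde (hact A (emb p))) (emb (poincare A p)).
Proof.
move=> p0; have [D0 _] := hact_pos A (emb_pos p0).
have Dn0 : hde (hact A (emb p)) != 0 by rewrite gt_eqF.
have := hact_dot A (emb p) (emb p).
rewrite poincare_coords hdot_emb /hdot; move: Dn0.
case: (hact A (emb p)) => al x y D /= Dn0 e; rewrite /hscale /emb /=.
congr Herm; last by rewrite mulr1.
- rewrite !expr_div_n -!mulrDl; apply: (mulIf Dn0).
  have -> : p.2 ^+ 2 = al * D - x ^+ 2 - y ^+ 2 by lra.
  by field.
- by field.
- by field.
Qed.

Lemma act_uhs g p : uhs p -> uhs (act g p).
Proof.
move=> p0; rewrite /act poincare_coords.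
by apply: divr_gt0 => //; have [] := hact_pos (repr g) (emb_pos p0).
Qed.

Lemma emb_act g p : uhs p ->
  gact g (emb p) = hscale (hde (gact g (emb p))) (emb (act g p)).
Proof. exact: poincareE. Qed.

Lemma gact_pos g v : hpos v -> hpos (gact g v).
Proof. exact: hact_pos. Qed.

Lemma hscaleA k l v : hscale k (hscale l v) = hscale (k * l) v.
Proof. by rewrite /hscale /= !mulrA. Qed.

Lemma actM g h p : uhs p -> act (g * h)%g p = act g (act h p).
Proof.
move=> p0; have hp0 := act_uhs h p0.
have [k0 _] := gact_pos h (emb_pos p0); have [l0 _] := gact_pos g (emb_pos hp0).
have := emb_act (g * h)%g p0; rewrite {1}gactM {1}(emb_act h p0) gactZ.
rewrite {1}(emb_act g hp0) hscaleA; move: (hde _ * hde _) (mulr_gt0 k0 l0) => k k_gt0.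
move: (hde _) => l e; apply/esym; apply: (@emb_inj _ _ (k^-1 * l)) => //; try exact: act_uhs.
by rewrite -hscaleA -e hscaleA mulVf ?gt_eqF // /hscale !mul1r; case: (emb _).
Qed.

Lemma act1 p : uhs p -> act 1%g p = p.
Proof.
move=> p0; apply: (@emb_inj _ _ (hde (gact 1%g (emb p)))^-1) => //; try exact: act_uhs.
have [k0 _] := gact_pos 1%g (emb_pos p0).
have := emb_act 1%g p0; rewrite {1}gact1 => {2}->.
by rewrite hscaleA mulVf ?gt_eqF // /hscale !mul1r; case: (emb _).
Qed.

Lemma actK g p : uhs p -> act g^-1%g (act g p) = p.
Proof. by move=> p0; rewrite -actM // mulVg act1. Qed.
Lemma actVK g p : uhs p -> act g (act g^-1%g p) = p.
Proof. by move=> p0; rewrite -actM // mulgV act1. Qed.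

Lemma translateM g h (A : set ambient) : A `<=` uhs ->
  translate (g * h)%g A = translate g (translate h A).
Proof.
move=> Auhs; apply/seteqP; split => [_ [p Ap <-]|_ [_ [p Ap <-] <-]].
  by rewrite actM; [exists (act h p) => //; exists p | exact: Auhs].
by exists p => //; rewrite actM //; exact: Auhs.
Qed.

Lemma translate1 (A : set ambient) : A `<=` uhs -> translate 1%g A = A.
Proof.
move=> Auhs; apply/seteqP; split => [_ [p Ap <-]|p Ap]; first by rewrite act1 //; exact: Auhs.
by exists p => //; rewrite act1 //; exact: Auhs.
Qed.

Lemma translate_uhs g (A : set ambient) : A `<=` uhs -> translate g A `<=` uhs.
Proof. by move=> Auhs _ [p /Auhs p0 <-]; exact: act_uhs. Qed.

Lemma translateK g (A : set ambient) : A `<=` uhs -> translate g^-1%g (translate g A) = A.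
Proof. by move=> Auhs; rewrite -translateM // mulVg translate1. Qed.
Lemma translateVK g (A : set ambient) : A `<=` uhs -> translate g (translate g^-1%g A) = A.
Proof. by move=> Auhs; rewrite -translateM // mulgV translate1. Qed.

Lemma mem_translate g (A : set ambient) p : A `<=` uhs -> uhs p ->
  translate g A p <-> A (act g^-1%g p).
Proof.
move=> Auhs p0; split => [[q Aq <-]|Ap].
  by rewrite actK //; exact: Auhs.
by exists (act g^-1%g p) => //; rewrite actVK.
Qed.

(** A conic condition on forms, read as a subset of hyperbolic space. *)
Definition region (C : herm R -> Prop) : set ambient := [set p | uhs p /\ C (emb p)].

Lemma region_uhs C : region C `<=` uhs. Proof. by move=> p []. Qed.

Definition conic (C : herm R -> Prop) := forall k v, 0 < k -> C v -> C (hscale k v).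

Lemma region_act C g p : conic C -> uhs p -> region C (act g p) <-> C (gact g (emb p)).
Proof.
move=> Cc p0; have [k0 _] := gact_pos g (emb_pos p0).
rewrite (emb_act g p0); split => [[_ Cp]|Cp]; first exact: Cc.
split; first exact: act_uhs.
have := Cc (hde (gact g (emb p)))^-1 _ _ Cp; rewrite invr_gt0 => /(_ k0).
by rewrite hscaleA mulVf ?gt_eqF // /hscale !mul1r; case: (emb _).
Qed.

Lemma region_translate C g p : conic C -> uhs p ->
  translate g (region C) p <-> C (gact g^-1%g (emb p)).
Proof.
by move=> Cc p0; rewrite mem_translate ?region_act //; exact: region_uhs.
Qed.

Lemma region_conicP C g v : conic C -> hpos v -> 
  forall p, v = hscale (hde v) (emb p) -> C (gact g v) <-> C (gact g (emb p)).
Proof.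
move=> Cc [d0 _] p e; rewrite e gactZ; split => [/(Cc (hde v)^-1)|/(Cc (hde v))]; last exact.
rewrite invr_gt0 hscaleA mulVf ?gt_eqF // => /(_ d0).
by rewrite /hscale !mul1r; case: (gact _ _).
Qed.

(** Equality of subsets of hyperbolic space becomes an equivalence between
    linear conditions on all positive forms. *)
Lemma translate_region_eq C C' g : conic C -> conic C' ->
  (translate g (region C) = region C' <-> forall v, hpos v -> C v <-> C' (gact g v)).
Proof.
move=> Cc Cc'; split=> [e v v0|e].
  have [p p0 vp] := emb_surj v0.
  rewrite (region_conicP g Cc' v0 vp) -region_act // -e mem_translate; last exact: act_uhs.
    rewrite actK //.
    have := region_conicP 1%g Cc v0 vp; rewrite !gact1 => ->.
    by split=> [|[]].
  exact: region_uhs.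
apply/seteqP; split => p pr.
  have p0 : uhs p by apply: translate_uhs pr; exact: region_uhs.
  split=> //; move: pr; rewrite region_translate // => /e; rewrite gactVK.
  by apply; exact/gact_pos/emb_pos.
have p0 : uhs p by case: pr.
rewrite region_translate //; apply/e; first exact/gact_pos/emb_pos.
by rewrite gactVK; case: pr.
Qed.

End Points.

(** * Ideal hulls in linear coordinates *)

Section Hulls.
Variable R : realType.
Local Notation ambient := (ambient R).
Local Notation uhs := (@upper_half_space R).
Implicit Types (p : ambient) (v n : herm R).

(** Ideal points are null vectors; an affine one is normalized by its last
    entry, so that the apex gives half of [vtx1 true]. *)
Definition ideal_form (z : ideal_point R) : herm R :=
  if z is Some w then Herm (sqnorm w) (complex.Re w) (complex.Im w) 1
  else Herm 1 0 0 0.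

(** Closed half-spaces are the conditions [0 <= hdot _ n] with n of negative
    norm, both for points and for ideal points. *)
Lemma ideal_hullE (V : set (ideal_point R)) p :
  ideal_hull V p <-> uhs p /\ forall n, hdot n n < 0 ->
    (forall z, V z -> 0 <= hdot (ideal_form z) n) -> 0 <= hdot (emb p) n.
Proof.
split=> -[p0 h]; split=> //.
  move=> n n0 nV.
  have hn : hde n * hal n < sqnorm (Complex (- hx n) (- hy n)).
    by move: n0; rewrite /hdot /sqnorm /=; lra.
  have := h (HalfSpace hn); rewrite /in_half_space /=.
  case: p {p0 h} => [[x y] t]; rewrite /hdot /sqnorm /height /zcoord /=.
  rewrite (_ : _ + hal n = (x ^+ 2 + y ^+ 2 + t ^+ 2) * hde n + 1 * hal n
     - 2 * x * hx n - 2 * y * hy n); last by ring.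
  apply=> -[[a b]|] /nV; rewrite /ideal_in_half_space /hdot /= /sqnorm /=; lra.
move=> [al be ga hM] MV; rewrite /in_half_space /=.
pose n := Herm ga (- complex.Re be) (- complex.Im be) al.
have n0 : hdot n n < 0 by have := hM; rewrite /hdot /sqnorm /=; lra.
have := h n n0; case: p {p0 h} => [[x y] t]; case: be hM MV @n n0 => b1 b2 hM MV n n0.
rewrite /hdot /sqnorm /height /zcoord /=.
rewrite (_ : _ + ga = (x ^+ 2 + y ^+ 2 + t ^+ 2) * al + 1 * ga
     - 2 * x * - b1 - 2 * y * - b2); last by ring.
apply=> -[[a b]|] /MV; rewrite /ideal_in_half_space /hdot /= /sqnorm /=; lra.
Qed.

Definition ivtx1 (b : bool) : ideal_point R := if b then apex R else None.
Definition ivtx2 (b : bool) : ideal_point R :=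
  if b then Some (Complex 1 1) else Some 0.
Definition ivtx3 (b : bool) : ideal_point R :=
  if b then Some (Complex 0 1) else Some 1.

Local Notation toR := (hmap (intr : int -> R)).

Lemma ivtx1E b n : (0 <= hdot (ideal_form (ivtx1 b)) n) = (0 <= hdot (toR (vtx1 b)) n).
Proof.
by case: b; rewrite /hdot /= /sqnorm /=; apply/idP/idP; lra.
Qed.
Lemma ivtx2E b n : (0 <= hdot (ideal_form (ivtx2 b)) n) = (0 <= hdot (toR (vtx2 b)) n).
Proof.
by case: b; rewrite /hdot /= /sqnorm /=; apply/idP/idP; lra.
Qed.
Lemma ivtx3E b n : (0 <= hdot (ideal_form (ivtx3 b)) n) = (0 <= hdot (toR (vtx3 b)) n).
Proof.
by case: b; rewrite /hdot /= /sqnorm /=; apply/idP/idP; lra.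
Qed.

(** A form is a combination of three vertices, chosen by the signs of its
    coordinates, and of the center, with coefficients which are nonnegative on
    the octahedral cone. *)
Lemma hdot_octE v n (b1 b2 b3 : bool) :
  (-1) ^+ b1 * lp v = `|lp v| -> (-1) ^+ b2 * lq v = `|lq v| ->
  (-1) ^+ b3 * lr v = `|lr v| ->
  hdot v n = `|lp v| * hdot (toR (vtx1 b1)) n + `|lq v| * hdot (toR (vtx2 b2)) n
    + `|lr v| * hdot (toR (vtx3 b3)) n
    + (ls v - `|lp v| - `|lq v| - `|lr v|) / 2 *
       (hdot (toR (vtx1 true)) n + hdot (toR (vtx1 false)) n).
Proof.
by move=> <- <- <-; rewrite /hdot /ls /lp /lq /lr; case: b1; case: b2; case: b3 => /=; field.
Qed.

(** The walls of the cone are themselves half-spaces that contain the vertices;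
    conversely [hdot_octE] writes a point of the cone as a nonnegative
    combination of vertices. *)
Lemma octahedronE : octahedron R = region (@in_oct R).
Proof.
have memV z : [set` [:: None; Some 0; Some 1; Some (Complex 0 1); Some (Complex 1 1); apex R]] z
   <-> exists b, [\/ z = ivtx1 b, z = ivtx2 b | z = ivtx3 b].
  rewrite /= !inE; split.
    do 5?[case/orP]; move/eqP=> ->;
      [exists false|exists false|exists false|exists true|exists true|exists true];
     by [apply: Or31|apply: Or32|apply: Or33].
  by case=> -[] [] ->; rewrite ?eqxx ?orbT.
rewrite /octahedron; apply/seteqP; split => p.
  move=> /ideal_hullE [p0 h]; split => // b; apply: h.
    by rewrite hdot_hmap ltrz0; case: b => [[[] []] []].
  move=> z /memV [c [] ->]; rewrite ?ivtx1E ?ivtx2E ?ivtx3E hdot_hmap ler0z;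
  by case: c; case: b => [[[] []] []].
case=> p0 po; apply/ideal_hullE; split=> // n _ nV.
(* The signs that select the three vertices. *)
have sgE (x : R) : (-1) ^+ (x < 0)%R * x = `|x| by rewrite normrEsign.
have /in_octE po' := po.
rewrite (hdot_octE n (sgE _) (sgE _) (sgE _)).
have n1 b : 0 <= hdot (toR (vtx1 b)) n.
  by rewrite -ivtx1E; apply/nV/memV; exists b; apply: Or31.
have n2 b : 0 <= hdot (toR (vtx2 b)) n.
  by rewrite -ivtx2E; apply/nV/memV; exists b; apply: Or32.
have n3 b : 0 <= hdot (toR (vtx3 b)) n.
  by rewrite -ivtx3E; apply/nV/memV; exists b; apply: Or33.
apply: addr_ge0; first by apply: addr_ge0; [apply: addr_ge0|]; apply: mulr_ge0; rewrite ?normr_ge0.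
by apply: mulr_ge0; [lra | exact: addr_ge0].
Qed.

Lemma in_faceE b v : in_face b v <->
  [/\ 0 <= (-1) ^+ b.1.1 * lp v, 0 <= (-1) ^+ b.1.2 * lq v, 0 <= (-1) ^+ b.2 * lr v
    & hdot v (toR (normal b)) = 0].
Proof.
split=> [[vo v0]|[h1 h2 h3 v0]].
  move: (v0); rewrite hdot_normal => v0'; split=> //.
  - by have := vo (~~ b.1.1, b.1.2, b.2); rewrite hdot_normal /= signrN; lra.
  - by have := vo (b.1.1, ~~ b.1.2, b.2); rewrite hdot_normal /= signrN; lra.
  - by have := vo (b.1.1, b.1.2, ~~ b.2); rewrite hdot_normal /= signrN; lra.
split=> //; apply/in_octE; move: v0; rewrite hdot_normal.
have sgE (c : bool) (x : R) : 0 <= (-1) ^+ c * x -> `|x| = (-1) ^+ c * x.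
  by move=> /ger0_norm <-; rewrite normrM normr_sign mul1r.
by rewrite (sgE _ _ h1) (sgE _ _ h2) (sgE _ _ h3); lra.
Qed.

(** Besides the plane of the face, used with both orientations, three half-spaces
    suffice: those that test the signs of the coordinates. *)
Lemma base_face_hullE b :
  ideal_hull [set` [:: ivtx1 b.1.1; ivtx2 b.1.2; ivtx3 b.2]] = region (@in_face R b).
Proof.
apply/seteqP; split => p.
  move=> /ideal_hullE [p0 h]; split => //.
  have {}h n : hdot n n < 0 -> 0 <= hdot (toR (vtx1 b.1.1)) n ->
      0 <= hdot (toR (vtx2 b.1.2)) n -> 0 <= hdot (toR (vtx3 b.2)) n -> 0 <= hdot (emb p) n.
    move=> n0 h1 h2 h3; apply: h => // z; rewrite /= !inE => /or3P[] /eqP ->;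
    by rewrite ?ivtx1E ?ivtx2E ?ivtx3E.
  apply/in_faceE; split.
  (* The vector with p = - (-1)^b and s = q = r = 0; likewise for q and r below. *)
  - have := h (Herm 0 ((-1) ^+ b.1.1 / 2) ((-1) ^+ b.1.1 / 2) ((-1) ^+ b.1.1)).
    by case: (b) => [[[] []] []]; rewrite /hdot /lp /=; lra.
  - have := h (Herm ((-1) ^+ b.1.2) ((-1) ^+ b.1.2 / 2) ((-1) ^+ b.1.2 / 2) 0).
    by case: (b) => [[[] []] []]; rewrite /hdot /lq /=; lra.
  - have := h (Herm 0 (- (-1) ^+ b.2 / 2) ((-1) ^+ b.2 / 2) 0).
    by case: (b) => [[[] []] []]; rewrite /hdot /lr /=; lra.
  - have := h (toR (normal b)); have := h (hscale (- 1) (toR (normal b))).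
    by case: (b) => [[[] []] []]; rewrite /hdot /=; lra.
case=> p0 /[dup] -[/in_octE po pn] /in_faceE [h1 h2 h3 _].
apply/ideal_hullE; split=> // n _ nV.
have sgE (c : bool) (x : R) : 0 <= (-1) ^+ c * x -> (-1) ^+ c * x = `|x|.
  by move=> /ger0_norm <-; rewrite normrM normr_sign mul1r.
rewrite (hdot_octE n (sgE _ _ h1) (sgE _ _ h2) (sgE _ _ h3)).
have -> : ls (emb p) - `|lp (emb p)| - `|lq (emb p)| - `|lr (emb p)| = 0.
  by rewrite -(sgE _ _ h1) -(sgE _ _ h2) -(sgE _ _ h3) -hdot_normal.
rewrite !mul0r addr0; apply: addr_ge0; [apply: addr_ge0|]; apply: mulr_ge0;
  by rewrite ?normr_ge0 // -?ivtx1E -?ivtx2E -?ivtx3E nV //= !inE eqxx ?orbT.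
Qed.

Lemma base_facesE F : base_faces F <-> exists b, F = region (@in_face R b).
Proof.
split=> [[u [v [w [hu hv hw ->]]]]|[b ->]].
  have [b1 ->] : exists b, u = ivtx1 b.
    by move: hu; rewrite !inE => /orP[] /eqP ->; [exists false|exists true].
  have [b2 ->] : exists b, v = ivtx2 b.
    by move: hv; rewrite !inE => /orP[] /eqP ->; [exists false|exists true].
  have [b3 ->] : exists b, w = ivtx3 b.
    by move: hw; rewrite !inE => /orP[] /eqP ->; [exists false|exists true].
  by exists (b1, b2, b3); rewrite -base_face_hullE.
exists (ivtx1 b.1.1), (ivtx2 b.1.2), (ivtx3 b.2); rewrite base_face_hullE.
by case: b => [[[] []] []]; split; rewrite ?inE ?eqxx ?orbT.
Qed.
End Hulls.

(** * Tiles, their faces and their neighbours *)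

Definition mkSL (a b c d : gauss) : SL2Zi :=
  insubd SL2one (\matrix_(i < 2, j < 2)
    if i == 0 then if j == 0 then a else b else if j == 0 then c else d).

Lemma mkSLE (a b c d : gauss) : a * d - b * c = 1 ->
  [/\ SL2val (mkSL a b c d) 0 0 = a, SL2val (mkSL a b c d) 0 1 = b,
      SL2val (mkSL a b c d) 1 0 = c & SL2val (mkSL a b c d) 1 1 = d].
Proof.
by move=> e; rewrite val_insubd det_mx22 !mxE /= e eqxx !mxE.
Qed.

(** Involutions of PSL2(Z[i]): the matrices have trace zero.  Each is the half-turn
    about a geodesic in the plane of a face, going through one ideal vertex and
    exchanging the two others. *)
Definition crossing_entries (b : face_index) : (gauss * gauss) * (gauss * gauss) :=
  let g (x y : int) : gauss := Complex x y in
  match b with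
  | (false, false, false) => ((g 0 0, g 0 (- 1)), (g 0 (- 1), g 0 0))
  | (false, false, true) => ((g 0 0, g (- 1) 0), (g 1 0, g 0 0))
  | (false, true, false) => ((g (- 1) 0, g 2 0), (g (- 1) 0, g 1 0))
  | (false, true, true) => ((g 1 0, g 0 (- 2)), (g 0 (- 1), g (- 1) 0))
  | (true, false, false) => ((g 1 0, g (- 1) 0), (g 2 0, g (- 1) 0))
  | (true, false, true) => ((g 1 0, g 0 (- 1)), (g 0 (- 2), g (- 1) 0))
  | (true, true, false) => ((g (- 2) 0, g 2 1), (g (- 2) 1, g 2 0))
  | (true, true, true) => ((g 2 0, g (- 1) (- 2)), (g 1 (- 2), g (- 2) 0))
  end.

Definition crossing (b : face_index) : PSL2Zi :=
  let: ((x, y), (z, t)) := crossing_entries b in \pi_PSL2Zi (mkSL x y z t).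

Definition crossing_act (T : comNzRingType) (b : face_index) : herm T -> herm T :=
  let: ((x, y), (z, t)) := crossing_entries b in
  hact8 (complex.Re x)%:~R (complex.Im x)%:~R (complex.Re y)%:~R (complex.Im y)%:~R
        (complex.Re z)%:~R (complex.Im z)%:~R (complex.Re t)%:~R (complex.Im t)%:~R.

Lemma gact_crossing (T : comNzRingType) b (v : herm T) :
  gact (crossing b) v = crossing_act b v.
Proof.
rewrite /crossing /crossing_act.
case e: (crossing_entries b) => [[x y] [z t]].
rewrite gact_pi /hact /reT /imT.
have [| -> -> -> -> //] := @mkSLE x y z t.
by case: b e => [[[] []] []] [<- <- <- <-].
Qed.

Lemma crossingK (T : comNzRingType) b (v : herm T) :
  gact (crossing b) (gact (crossing b) v) = v.
Proof.
rewrite !gact_crossing; case: b => [[[] []] []]; case: v => al x y de;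
rewrite /crossing_act /= /hact8 /=; congr Herm; ring.
Qed.

(** The right-hand side is the reflection of [ocenter] in the plane of the face. *)
Lemma crossing_ocenter b :
  gact (crossing b) ocenter = hadd ocenter (hscale 2 (normal b)).
Proof. by rewrite gact_crossing; case: b => [[[] []] []]. Qed.

Section Tiles.
Variable R : realType.
Local Notation ambient := (ambient R).
Local Notation uhs := (@upper_half_space R).
Local Notation toR := (hmap (intr : int -> R)).
Implicit Types (g h k : PSL2Zi) (b : face_index) (Q F : set ambient).

Local Notation oct := (octahedron R).
Definition face b : set ambient := region (@in_face R b).

Lemma in_oct_toR (v : herm int) : in_oct (toR v) <-> in_oct v.
Proof.
by split=> h b; have := h b; rewrite ?hmap_int ?hdot_hmap ?ler0z // hdot_hmap hmap_int ler0z.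
Qed.

Lemma in_face_toR b (v : herm int) : in_face b (toR v) <-> in_face b v.
Proof.
rewrite /in_face in_oct_toR hmap_int hdot_hmap.
by split=> -[h1 /eqP]; rewrite ?intr_eq0 => h2; split=> //; apply/eqP; rewrite ?intr_eq0.
Qed.

Lemma conic_oct : conic (@in_oct R).
Proof. by move=> k v k0 h b; rewrite hdotZl pmulr_rge0. Qed.

Lemma conic_face b : conic (@in_face R b).
Proof. by move=> k v k0 [h h0]; split; [exact: conic_oct | rewrite hdotZl h0 mulr0]. Qed.

Lemma oct_uhs : oct `<=` uhs.
Proof. by rewrite octahedronE; exact: region_uhs. Qed.

Lemma heven_gact g v : heven v -> heven (gact g v).
Proof. exact: heven_hact. Qed.

Lemma gact_ocenter_oct g : in_oct (gact g ocenter) -> gact g ocenter = ocenter.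
Proof.
move=> h; apply: ocenter_rigid => //; first exact/heven_gact/heven_ocenter.
by rewrite gact_dot.
Qed.

Lemma ocenter_pos : hpos (toR ocenter).
Proof. by split; rewrite ?hdot_hmap ltr0z. Qed.

Lemma in_oct_ocenter : in_oct ocenter.
Proof. by case=> [[[] []] []]. Qed.

(** The normals are characterized by their norm and their product with the
    center. *)
Lemma stab_normal k b : gact k ocenter = ocenter ->
  exists b', gact k (normal b) = normal b'.
Proof.
move=> kC; apply: facet_normalP; rewrite ?gact_dot; last by case: b => [[[] []] []].
by rewrite -{1}kC gact_dot; case: b => [[[] []] []].
Qed.

Lemma gactV_ocenter k : gact k ocenter = ocenter -> gact k^-1%g ocenter = ocenter.
Proof. by move=> {1}<-; rewrite gactK. Qed.

(** The walls of the octahedron are permuted. *)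
Lemma stab_in_oct k (v : herm R) : gact k ocenter = ocenter ->
  in_oct v <-> in_oct (gact k v).
Proof.
suff P h w : gact h ocenter = ocenter -> in_oct w -> in_oct (gact h (w : herm R)).
  move=> kC; split; first exact: P.
  by move/(P _ _ (gactV_ocenter kC)); rewrite gactK.
move=> hC wo b; rewrite gact_dotV gact_hmap.
by have [b' ->] := stab_normal b (gactV_ocenter hC).
Qed.

(** If k preserves O then kC lies in O, hence is C by rigidity; if k fixes C it
    permutes the walls of O. *)
Lemma stabE k : stab_octahedron R k <-> gact k ocenter = ocenter.
Proof.
rewrite /stab_octahedron /= octahedronE translate_region_eq; try exact: conic_oct.
split=> [h|kC v _]; last exact: stab_in_oct.
apply: gact_ocenter_oct; rewrite -in_oct_toR -gact_hmap -h; last exact: ocenter_pos.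
exact/in_oct_toR/in_oct_ocenter.
Qed.

Lemma tile_eqE g h : translate g oct = translate h oct <-> gact g ocenter = gact h ocenter.
Proof.
have -> : translate g oct = translate h oct <-> stab_octahedron R (h^-1 * g)%g.
  rewrite /stab_octahedron /= translateM; last exact: oct_uhs.
  have ou h' : translate h' oct `<=` uhs by apply: translate_uhs; exact: oct_uhs.
  by split=> [->|/(congr1 (translate h))]; rewrite ?translateK ?translateVK //; exact: oct_uhs.
rewrite stabE gactM; split=> [e|->]; last by rewrite gactK.
by rewrite -{2}e gactVK.
Qed.

Lemma face_uhs b : face b `<=` uhs. Proof. exact: region_uhs. Qed.

Lemma stab_face k b : gact k ocenter = ocenter ->
  exists b', translate k (face b) = face b'.
Proof.
move=> kC; have [b' kb] := stab_normal b kC; exists b'.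
apply/(translate_region_eq k (@conic_face b) (@conic_face b')) => v _.
by rewrite /in_face -(stab_in_oct _ kC) -kb -gact_hmap gact_dot.
Qed.

Lemma facesE g F : faces (translate g oct) F <-> exists b, F = translate g (face b).
Proof.
split=> [[g' [F0 [e /base_facesE[b ->] ->]]]|[b ->]]; last first.
  by exists g, (face b); split=> //; apply/base_facesE; exists b.
move/tile_eqE: e => e.
have [|b' fb] := @stab_face (g^-1 * g')%g b; first by rewrite gactM -e gactK.
exists b'; rewrite -fb -translateM; last exact: face_uhs.
by rewrite mulgA mulgV mul1g.
Qed.

Lemma edge_in_face b :
  [/\ in_face b (edge12 b), in_face b (edge13 b) & in_face b (edge23 b)].
Proof.
by case: b => [[[] []] []]; split;
  (split; [case=> [[[] []] []]; exact: isT | exact: erefl]).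
Qed.

(** The three edge vectors of the first face go to integral vectors of norm 2 in
    the second face, hence to its edge vectors ([edgeP]), and injectively because
    distinct edge vectors have product 3.  So the image of the center has product
    4 with each edge vector of the second face, and [face_centerP] applies. *)
Lemma face_match b b' g : translate g (face b) = face b' ->
  gact g ocenter = ocenter \/ gact g ocenter = gact (crossing b') ocenter.
Proof.
move/(translate_region_eq g (@conic_face b) (@conic_face b')) => e.
have E v : in_face b v -> hdot v v = 2 -> 0 < hde v ->
    [\/ gact g v = edge12 b', gact g v = edge13 b' | gact g v = edge23 b'].
  move=> vb v2 v0; apply: edgeP; last by rewrite gact_dot.
  rewrite -in_face_toR -gact_hmap -e ?in_face_toR //.
  by split; rewrite ?hdot_hmap ?v2 ltr0z.
have {E} [e12 e13 e23] : [/\ [\/ gact g (edge12 b) = edge12 b',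
      gact g (edge12 b) = edge13 b' | gact g (edge12 b) = edge23 b'],
    [\/ gact g (edge13 b) = edge12 b', gact g (edge13 b) = edge13 b'
      | gact g (edge13 b) = edge23 b']
  & [\/ gact g (edge23 b) = edge12 b', gact g (edge23 b) = edge13 b'
      | gact g (edge23 b) = edge23 b']].
  have [i12 i13 i23] := edge_in_face b.
  by split; apply: E => //; case: (b) => [[[] []] []].
have d1 : hdot (gact g (edge12 b)) (gact g (edge13 b)) = 3.
  by rewrite gact_dot; case: (b) => [[[] []] []].
have d2 : hdot (gact g (edge12 b)) (gact g (edge23 b)) = 3.
  by rewrite gact_dot; case: (b) => [[[] []] []].
have d3 : hdot (gact g (edge13 b)) (gact g (edge23 b)) = 3.
  by rewrite gact_dot; case: (b) => [[[] []] []].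
have c1 : hdot (gact g ocenter) (gact g (edge12 b)) = 4.
  by rewrite gact_dot; case: (b) => [[[] []] []].
have c2 : hdot (gact g ocenter) (gact g (edge13 b)) = 4.
  by rewrite gact_dot; case: (b) => [[[] []] []].
have c3 : hdot (gact g ocenter) (gact g (edge23 b)) = 4.
  by rewrite gact_dot; case: (b) => [[[] []] []].
have n12 : hdot (edge12 b') (edge12 b') = 2 by case: (b') => [[[] []] []].
have n13 : hdot (edge13 b') (edge13 b') = 2 by case: (b') => [[[] []] []].
have n23 : hdot (edge23 b') (edge23 b') = 2 by case: (b') => [[[] []] []].
rewrite crossing_ocenter; apply: (@face_centerP b'); rewrite ?gact_dot //;
case: e12 e13 e23 => [] x1 [] x2 [] x3;
move: c1 c2 c3 d1 d2 d3; rewrite ?x1 ?x2 ?x3 ?n12 ?n13 ?n23 //.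
Qed.

Lemma crossing_in_face b (v : herm R) : in_face b v -> in_face b (gact (crossing b) v).
Proof.
move=> /in_faceE h; apply/in_faceE; move: h.
rewrite gact_crossing; case: b => [[[] []] []]; case: v => al x y de;
rewrite /crossing_act /= /hact8 /lp /lq /lr /hdot /= => -[]; split; lra.
Qed.

Lemma crossing_face b : translate (crossing b) (face b) = face b.
Proof.
apply/(translate_region_eq _ (@conic_face b) (@conic_face b)) => v _.
split; first exact: crossing_in_face.
by move/crossing_in_face; rewrite crossingK.
Qed.

Lemma crossing_neq b : gact (crossing b) ocenter <> ocenter.
Proof. by rewrite crossing_ocenter; case: b => [[[] []] []]. Qed.

Definition neighbour g b := translate (g * crossing b)%g oct.

(** A tile through the face has one of the two centers of [face_match]. *)
Lemma neighbourP g b : let F := translate g (face b) in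
  [/\ neighbour g b <> translate g oct, faces (neighbour g b) F &
    forall Q, faces Q F -> Q = translate g oct \/ Q = neighbour g b].
Proof.
move=> F; split.
- move/tile_eqE; rewrite gactM => /(congr1 (gact g^-1%g)); rewrite !gactK.
  exact: crossing_neq.
- apply/facesE; exists b; rewrite translateM; last exact: face_uhs.
  by rewrite crossing_face.
- move=> Q [g' [F0 [-> /base_facesE[b' ->] e]]].
  have := @face_match b' b (g^-1 * g')%g.
  rewrite translateM; last exact: face_uhs.
  rewrite -[translate g' _]e translateK; last exact: face_uhs.
  case=> //; rewrite gactM => /(congr1 (gact g)); rewrite gactVK => e'.
    by left; apply/tile_eqE.
  by right; apply/tile_eqE; rewrite gactM.
Qed.

End Tiles.

(** * Interiors and connectedness of tiles *)

Lemma pair_continuous_for (T U V : topologicalType) (f : T -> U) (g : T -> V) x :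
  {for x, continuous f} -> {for x, continuous g} ->
  {for x, continuous (fun y => (f y, g y))}.
Proof. by move=> cf cg; exact: (cvg_pair cf cg). Qed.

Section Topology.
Variable R : realType.
Local Notation ambient := (ambient R).
Local Notation uhs := (@upper_half_space R).
Local Notation toR := (hmap (intr : int -> R)).
Implicit Types (g h k : PSL2Zi) (b : face_index) (Q F : set ambient).

Local Notation oct := (octahedron R).

Lemma continuous_x : continuous (fun p : ambient => p.1.1).
Proof. by move=> p; apply: (@continuous_comp _ _ _ (fun p : R*R*R => p.1) fst); exact: cvg_fst. Qed.
Lemma continuous_y : continuous (fun p : ambient => p.1.2).
Proof.
move=> p; apply: (@continuous_comp _ _ _ (fun p : R*R*R => p.1) snd);
  [exact: cvg_fst|exact: cvg_snd].
Qed.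
Lemma continuous_t : continuous (fun p : ambient => p.2).
Proof. by move=> p; exact: cvg_snd. Qed.

Lemma continuous_emb (a b c d : R) :
  continuous (fun p : ambient =>
    a * hal (emb p) + b * hx (emb p) + c * hy (emb p) + d * hde (emb p)).
Proof.
have cx := continuous_x; have cy := continuous_y; have ct := continuous_t.
have sq (f : ambient -> R) : continuous f -> continuous (fun p => f p ^+ 2).
  by move=> cf p; exact: cvgM (cf p) (cf p).
move=> p; rewrite /=; apply: cvgD; last exact: cvg_cst.
apply: cvgD; last by apply: cvgM; [exact: cvg_cst|exact: cy].
apply: cvgD; last by apply: cvgM; [exact: cvg_cst|exact: cx].
apply: cvgM; first exact: cvg_cst.
by apply: cvgD; [apply: cvgD|]; apply: sq.
Qed.

Lemma continuous_hdot_emb (n : herm R) : continuous (fun p : ambient => hdot (emb p) n).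
Proof.
have -> : (fun p : ambient => hdot (emb p) n) = (fun p => hde n * hal (emb p)
  + (- 2 * hx n) * hx (emb p) + (- 2 * hy n) * hy (emb p) + hal n * hde (emb p)).
  by apply/funext => p; rewrite /hdot; ring.
exact: continuous_emb.
Qed.

Lemma continuous_act g p : uhs p -> {for p, continuous (act g : ambient -> ambient)}.
Proof.
move=> p0; have [D0 _] := gact_pos g (emb_pos p0).
have lin (n : herm R) : continuous (fun q : ambient => hdot (gact g (emb q)) n).
  under eq_fun do rewrite gact_dotV.
  exact: continuous_hdot_emb.
have cde : continuous (fun q : ambient => hde (gact g (emb q))).
  rewrite (_ : (fun q => _) = fun q => hdot (gact g (emb q)) (Herm 1 0 0 0)); first exact: lin.
  by apply/funext => q; rewrite /hdot /=; ring.
have cx : continuous (fun q : ambient => hx (gact g (emb q))).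
  rewrite (_ : (fun q => _) = fun q => hdot (gact g (emb q)) (Herm 0 (- 2^-1) 0 0));
    first exact: lin.
  by apply/funext => q; rewrite /hdot /=; field.
have cy : continuous (fun q : ambient => hy (gact g (emb q))).
  rewrite (_ : (fun q => _) = fun q => hdot (gact g (emb q)) (Herm 0 0 (- 2^-1) 0));
    first exact: lin.
  by apply/funext => q; rewrite /hdot /=; field.
have cV : {for p, continuous (fun q : ambient => (hde (gact g (emb q)))^-1)}.
  by apply: cvgV; [rewrite gt_eqF | exact: cde].
have -> : act g = fun q : ambient => (hx (gact g (emb q)) * (hde (gact g (emb q)))^-1,
     hy (gact g (emb q)) * (hde (gact g (emb q)))^-1, q.2 * (hde (gact g (emb q)))^-1).
  by apply/funext => q; rewrite /act poincare_coords.
apply: pair_continuous_for.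
  by apply: pair_continuous_for; apply: cvgM => //; [exact: cx|exact: cy].
by apply: cvgM => //; exact: continuous_t.
Qed.

Lemma open_uhs : open uhs.
Proof.
rewrite (_ : uhs = (fun p : ambient => p.2) @^-1` [set x | 0 < x]) //.
by apply: open_comp; [move=> p _; exact: continuous_t|exact: open_gt].
Qed.

Lemma open_translate g (A : set ambient) : A `<=` uhs -> open A -> open (translate g A).
Proof.
move=> Auhs Ao; rewrite openE => p pA.
have p0 : uhs p by apply: translate_uhs pA.
have gpA : A (act g^-1%g p) by apply/mem_translate.
have := @continuous_act g^-1%g p p0 _ (open_nbhs_nbhs (conj Ao gpA)).
have := open_nbhs_nbhs (conj open_uhs p0).
apply: filterS2 => q q0 Aq; exact/mem_translate.
Qed.

(** An element of G and its inverse both map open subsets of the open upper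
    half-space to open sets. *)
Lemma interior_translate g (A : set ambient) : A `<=` uhs ->
  interior (translate g A) = translate g (interior A).
Proof.
(* One inclusion suffices, applied to g and to its inverse. *)
have P h (B : set ambient) : B `<=` uhs -> translate h (interior B) `<=` interior (translate h B).
  move=> Bu; have iu : interior B `<=` uhs by apply: subset_trans Bu; exact: interior_subset.
  rewrite -open_subsetE; last by apply: open_translate => //; exact: open_interior.
  by move=> _ [p /interior_subset Bp <-]; exists p.
move=> Au; have iu : interior A `<=` uhs by apply: subset_trans Au; exact: interior_subset.
apply/seteqP; split; last exact: P.
have tu : translate g A `<=` uhs by exact: translate_uhs.
move=> p pi; have p0 : uhs p := tu _ (interior_subset pi).
apply/mem_translate => //; rewrite -[A](translateK g) //.
by apply: P => //; exists p.
Qed.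

Lemma ocenter_interior : exists2 p : ambient, interior oct p &
  exists2 k, 0 < k & toR ocenter = hscale k (emb p).
Proof.
have [p p0 e] := emb_surj (ocenter_pos R).
have [k0 _] := ocenter_pos R.
exists p; last by exists (hde (toR ocenter)).
rewrite octahedronE.
have near_pos (b : face_index) : \forall q \near p, 0 < hdot (emb q) (toR (normal b)).
  apply: (@continuous_hdot_emb (toR (normal b)) p [set x | 0 < x]).
  apply: open_nbhs_nbhs; split; first exact: open_gt.
  rewrite /= -(pmulr_rgt0 _ k0) -hdotZl -e hdot_hmap ltr0z.
  by case: b => [[[] []] []].
have near_uhs := open_nbhs_nbhs (conj open_uhs p0).
have nb : nbhs p [set q | forall b, 0 < hdot (emb q) (toR (normal b))].
  exact: (@filter_forall _ _ _ _ (nbhs_filter p) near_pos).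
have sub : uhs `&` [set q | forall b, 0 < hdot (emb q) (toR (normal b))] `<=` region (@in_oct R).
  by move=> q [q0 qb]; split=> // b; exact/ltW/qb.
exact: (@filterS _ _ (nbhs_filter p) _ _ sub (@filterI _ _ (nbhs_filter p) _ _ near_uhs nb)).
Qed.

(** The center of the first tile is interior to the second, so the two centers
    agree by rigidity. *)
Lemma tile_interior_inj g h :
  interior (translate g oct) = interior (translate h oct) ->
  translate g oct = translate h oct.
Proof.
have [p pi [k k0 e]] := ocenter_interior.
have p0 : uhs p := oct_uhs (interior_subset pi).
rewrite interior_translate; last exact: oct_uhs.
move=> gh; have : interior (translate h oct) (act g p) by rewrite -gh; exists p.
move/interior_subset; rewrite mem_translate; [|exact: oct_uhs|exact: act_uhs].
rewrite -actM // octahedronE region_act //; last exact: conic_oct.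
move/(conic_oct k0); rewrite -gactZ -e gact_hmap in_oct_toR => /gact_ocenter_oct.
rewrite gactM -octahedronE => c; apply/tile_eqE.
by rewrite -{2}c gactVK.
Qed.

Lemma connected_path (f : R -> ambient) : continuous f -> connected (f @` `[0, 1]).
Proof.
move=> cf; apply: connected_continuous_connected; first exact: segment_connected.
exact: continuous_subspaceT.
Qed.

Lemma continuous_line (a0 a1 b0 b1 c0 c1 : R) :
  continuous (fun s : R => (a0 + s * a1, b0 + s * b1, c0 + s * c1) : ambient).
Proof.
have lin (u v : R) : continuous (fun s : R => u + s * v).
  by move=> s; apply: cvgD; [exact: cvg_cst|apply: cvgM; [exact: cvg_id|exact: cvg_cst]].
move=> s.
exact: (pair_continuous_for (pair_continuous_for (lin a0 a1 s) (lin b0 b1 s)) (lin c0 c1 s)).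
Qed.

Lemma mem_octE (x y t : R) : oct ((x, y, t) : ambient) <->
  [/\ 0 < t, [/\ 0 <= y, 0 <= 1 - x, 0 <= x & 0 <= 1 - y] &
    [/\ x <= x ^+ 2 + y ^+ 2 + t ^+ 2, y <= x ^+ 2 + y ^+ 2 + t ^+ 2,
        2 * x + y - 1 <= x ^+ 2 + y ^+ 2 + t ^+ 2
      & x + 2 * y - 1 <= x ^+ 2 + y ^+ 2 + t ^+ 2]].
Proof.
rewrite octahedronE; split.
  case; rewrite /upper_half_space /height /= => t0 h; move: t0.
  have := h (false, false, false); have := h (false, false, true).
  have := h (false, true, false); have := h (false, true, true).
  have := h (true, false, false); have := h (true, false, true).
  have := h (true, true, false); have := h (true, true, true).
  rewrite !hdot_normal /ls /lp /lq /lr /=; by do 9![move=> ?]; split=> //; split; lra.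
case=> t0 [h1 h2 h3 h4] [h5 h6 h7 h8]; split=> // b.
by rewrite hdot_normal /ls /lp /lq /lr; case: b => [[[] []] []] /=; lra.
Qed.

(** Star-shaped in two steps: a point goes up by 1, stays in the octahedron since
    moving up only leaves hemispheres, and then goes straight to the point over
    (1 + i) / 2 at height 1 through the part of height at least 1. *)
Lemma oct_connected : connected oct.
Proof.
(* The two segments, with a parameter in [0, 1]. *)
pose up (p : ambient) (s : R) : ambient := (p.1.1 + s * 0, p.1.2 + s * 0, p.2 + s * 1).
pose over (p : ambient) (s : R) : ambient :=
  (p.1.1 + s * (2^-1 - p.1.1), p.1.2 + s * (2^-1 - p.1.2), p.2 + 1 + s * - p.2).
have upc p : connected (up p @` `[0, 1]) by apply/connected_path/continuous_line.
have overc p : connected (over p @` `[0, 1]) by apply/connected_path/continuous_line.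
have above (x y t : R) : 0 <= x -> x <= 1 -> 0 <= y -> y <= 1 -> 1 <= t ->
    oct ((x, y, t) : ambient).
  move=> *; have ? : 1 <= t ^+ 2 by rewrite exprn_ege1.
  have := sqr_ge0 x; have := sqr_ge0 y; have := sqr_ge0 (x - 1); have := sqr_ge0 (y - 1).
  by do 4![move=> ?]; apply/mem_octE; split; [lra|split; lra|split; lra].
have -> : oct = \bigcup_(p in oct) (up p @` `[0, 1] `|` over p @` `[0, 1]).
  apply/seteqP; split=> [p po|q [p po]].
    exists p => //; left; exists 0; first by rewrite /= in_itv /= lexx ler01.
    by rewrite /up !mul0r !addr0; case: p {po} => [[? ?] ?].
  case: p po => [[x y] t] /mem_octE [t0 [y0 x1 x0 y1] [h1 h2 h3 h4]].
  case=> -[s]; rewrite /= in_itv /= => /andP[s0 s1] <-.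
    apply/mem_octE; rewrite /up /=.
    by rewrite !mulr0 !addr0 mulr1; split; [lra|split|split]; nra.
  have := mulr_ge0 s0 x0; have := mulr_ge0 s0 y0; have := mulr_ge0 s0 x1.
  have := mulr_ge0 s0 y1 => sy1 sx1 sy sx.
  have s1' : 0 <= 1 - s by lra.
  have := mulr_ge0 s1' x0; have := mulr_ge0 s1' y0; have := mulr_ge0 s1' (ltW t0).
  have := mulr_ge0 s1' x1; have := mulr_ge0 s1' y1 => ry1 rx1 rt ry rx.
  by rewrite /over /=; apply: above; lra.
apply: bigcup_connected.
  exists (2^-1, 2^-1, 1) => p _; right; exists 1; first by rewrite /= in_itv /= lexx ler01.
  by rewrite /over; congr (_, _, _); ring.
move=> p _; apply: connectedU => //.
exists (p.1.1, p.1.2, p.2 + 1); split.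
  by exists 1; rewrite /= ?in_itv /= ?lexx ?ler01 // /up !mulr0 !addr0 mulr1.
by exists 0; rewrite /= ?in_itv /= ?lexx ?ler01 // /over !mul0r !addr0.
Qed.

Lemma tile_connected g : connected (translate g oct).
Proof.
apply: connected_continuous_connected; first exact: oct_connected.
apply: continuous_in_subspaceT => p /set_mem /oct_uhs; exact: continuous_act.
Qed.

End Topology.

(** * The stabilizer of the octahedron *)

Definition int_quad : Type := ((int * int) * (int * int) * ((int * int) * (int * int)))%type.

(** One representative up to sign of each of the 24 matrices that fix [ocenter];
    the quadruple lists the entries a, b, c, d as pairs of integers. *)
Definition stab_quads : seq int_quad := let m : int := - 1 in
 [:: ((1,1), (0,m), ((1,0), (0,m)));
     ((1,0), (0,0), ((0,0), (1,0)));
     ((1,0), (0,m), ((0,m), (0,0)));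
     ((1,0), (m,0), ((1,0), (0,0)));
     ((1,0), (m,m), ((1,m), (m,0)));
     ((1,m), (m,0), ((0,m), (0,1)));
     ((0,1), (1,0), ((0,1), (1,m)));
     ((0,1), (1,m), ((0,0), (0,m)));
     ((0,1), (0,0), ((1,1), (0,m)));
     ((0,1), (0,m), ((1,0), (m,m)));
     ((0,0), (1,0), ((m,0), (1,0)));
     ((0,0), (0,1), ((0,1), (1,0))) ].

Definition quad_opp (q : int_quad) : int_quad :=
  let: ((a, a'), (b, b'), ((c, c'), (d, d'))) := q in
  ((- a, - a'), (- b, - b'), ((- c, - c'), (- d, - d'))).

Definition quad_fixes (q : int_quad) : bool :=
  let: ((a, a'), (b, b'), ((c, c'), (d, d'))) := q in
  let v := hact8 a a' b b' c c' d d' ocenter in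
  [&& a * d - a' * d' - (b * c - b' * c') == 1, a * d' + a' * d - (b * c' + b' * c) == 0,
      hal v == 2, hx v == 1, hy v == 1 & hde v == 2].

Lemma quad_fixes_enum :
  let r : seq int := [:: - 1; 0; 1] in
  all (fun a => all (fun a' => all (fun b => all (fun b' =>
  all (fun c => all (fun c' => all (fun d => all (fun d' =>
    quad_fixes ((a, a'), (b, b'), ((c, c'), (d, d'))) ==>
    (((a, a'), (b, b'), ((c, c'), (d, d'))) \in stab_quads)
    || (quad_opp ((a, a'), (b, b'), ((c, c'), (d, d'))) \in stab_quads))
  r) r) r) r) r) r) r) r.
Proof. by vm_compute. Qed.

Definition quad_PSL (q : int_quad) : PSL2Zi :=
  let: ((a, a'), (b, b'), ((c, c'), (d, d'))) := q in
  \pi_PSL2Zi (mkSL (Complex a a') (Complex b b') (Complex c c') (Complex d d')).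

Lemma stab_quads_fix : all quad_fixes stab_quads.
Proof. by vm_compute. Qed.

Lemma quad_det a a' b b' c c' d d' :
  quad_fixes ((a, a'), (b, b'), ((c, c'), (d, d'))) ->
  (Complex a a' : gauss) * Complex d d' - (Complex b b' : gauss) * Complex c c' = 1.
Proof. by case/and3P => /eqP e1 /eqP e2 _; rewrite -[RHS]/(Complex 1 0) -e1 -e2. Qed.

Lemma quad_PSL_fix q : quad_fixes q -> gact (quad_PSL q) ocenter = ocenter.
Proof.
case: q => [[[a a'] [b b']] [[c c'] [d d']]] /[dup] /quad_det e /and5P[_ _].
have [e1 e2 e3 e4] := mkSLE e.
rewrite /quad_PSL gact_pi /hact /reT /imT e1 e2 e3 e4 /= !intz.
move=> /eqP h1 /eqP h2 /andP[/eqP h3 /eqP h4].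
by congr Herm; [exact: h1|exact: h2|exact: h3|exact: h4].
Qed.

Lemma matrix2P (S : Type) (A B : 'M[S]_2) :
  A 0 0 = B 0 0 -> A 0 1 = B 0 1 -> A 1 0 = B 1 0 -> A 1 1 = B 1 1 -> A = B.
Proof.
move=> e1 e2 e3 e4; apply/matrixP => i j.
have I2 (k : 'I_2) : k = 0 \/ k = 1.
  by case: k => [[|[|//]] h]; [left|right]; apply/val_inj.
by case: (I2 i) => ->; case: (I2 j) => ->.
Qed.

(** The left-hand side is |a|^2 plus two squares and also |b|^2 plus two squares, so
    the square of each of the four integers is at most 2. *)
Lemma unit_row (a a' b b' : int) :
  (a ^+ 2 + a' ^+ 2) * 2 + 2 * ((a * b + a' * b') * 1 + (a * b' - a' * b) * 1)
    + (b ^+ 2 + b' ^+ 2) * 2 = 2 ->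
  [/\ a \in [:: - 1; 0; 1], a' \in [:: - 1; 0; 1],
      b \in [:: - 1; 0; 1] & b' \in [:: - 1; 0; 1]].
Proof.
move=> e.
have small (x : int) : x ^+ 2 <= 2 -> x \in [:: - 1; 0; 1].
  move=> h; have : x = -1 \/ x = 0 \/ x = 1 by nia.
  by case=> [->|[->|->]].
have ea : a ^+ 2 + a' ^+ 2 + (a + b + b') ^+ 2 + (a' + b' - b) ^+ 2 = 2 by lra.
have eb : b ^+ 2 + b' ^+ 2 + (b + a - a') ^+ 2 + (b' + a + a') ^+ 2 = 2 by lra.
have := sqr_ge0 a; have := sqr_ge0 a'; have := sqr_ge0 b; have := sqr_ge0 b'.
have := sqr_ge0 (a + b + b'); have := sqr_ge0 (a' + b' - b).
have := sqr_ge0 (b + a - a'); have := sqr_ge0 (b' + a + a') => *.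
by split; apply: small; lra.
Qed.

(** By [unit_row] applied to both rows, finitely many matrices have to be checked. *)
Lemma ocenter_stabP k : gact k ocenter = ocenter <->
  exists2 q, q \in stab_quads & k = quad_PSL q.
Proof.
split=> [|[q qs ->]]; last exact/quad_PSL_fix/(allP stab_quads_fix).
elim/quotW: k => A; rewrite gact_pi => AC.
have [q qA qf] : exists2 q : int_quad, q =
    ((reT int A 0 0, imT int A 0 0), (reT int A 0 1, imT int A 0 1),
     ((reT int A 1 0, imT int A 1 0), (reT int A 1 1, imT int A 1 1))) & quad_fixes q.
  eexists; first by [].
  have [e1 e2] := det_entries int A; move: AC => [e3 e4 e5 e6].
  by rewrite /quad_fixes e1 e2 /= e3 e4 e5 e6.
have [r1 r2] : quad_PSL q = \pi_PSL2Zi A /\ quad_PSL (quad_opp q) = \pi_PSL2Zi A.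
  have := quad_det (a := (reT int A 0 0)); rewrite qA in qf * => /(_ _ _ _ _ _ _ _ qf) det.
  have [f1 f2 f3 f4] := mkSLE det.
  have eC (i j : 'I_2) : Complex (reT int A i j) (imT int A i j) = SL2val A i j.
    by rewrite /reT /imT !intz; case: (SL2val A i j).
  rewrite /quad_PSL /=; split; apply/eqmodP; rewrite /= /eq_sign.
    by apply/orP; left; apply/eqP/matrix2P; rewrite ?f1 ?f2 ?f3 ?f4 eC.
  have [| g1 g2 g3 g4] := @mkSLE
      (- SL2val A 0 0) (- SL2val A 0 1) (- SL2val A 1 0) (- SL2val A 1 1).
    by rewrite !mulrNN -!eC.
  apply/orP; right; apply/eqP; rewrite -!eC in g1 g2 g3 g4.
  by apply/matrix2P; rewrite mxE -eC ?g1 ?g2 ?g3 ?g4.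
have : (q \in stab_quads) || (quad_opp q \in stab_quads); last first.
  by case/orP => qs; [exists q | exists (quad_opp q)].
move: AC => [e3 _ _ e6].
have [a1 a2 a3 a4] := unit_row e3; have [a5 a6 a7 a8] := unit_row e6.
have /allP/(_ _ a1)/allP/(_ _ a2)/allP/(_ _ a3)/allP/(_ _ a4) := quad_fixes_enum.
move=> /allP/(_ _ a5)/allP/(_ _ a6)/allP/(_ _ a7)/allP/(_ _ a8).
by rewrite -qA qf.
Qed.

Lemma quad_PSL_uniq : uniq (map quad_PSL stab_quads).
Proof.
rewrite map_inj_in_uniq // => q q' qs qs'.
have := allP stab_quads_fix _ qs; have := allP stab_quads_fix _ qs'.
have : q' != quad_opp q.
  have : all (fun q => all (fun q' => q' != quad_opp q) stab_quads) stab_quads by vm_compute.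
  by move=> /allP/(_ _ qs)/allP/(_ _ qs').
case: q q' {qs qs'} => [[[a a'] [b b']] [[c c'] [d d']]] [[[e e'] [f f']] [[g g'] [h h']]].
move=> qq' /quad_det/mkSLE [e1 e2 e3 e4] /quad_det/mkSLE [f1 f2 f3 f4].
move/eqmodP; rewrite /= /eq_sign => /orP[] /eqP /matrixP m.
  move: (m 0 0) (m 0 1) (m 1 0) (m 1 1); rewrite e1 e2 e3 e4 f1 f2 f3 f4.
  by move=> [-> ->] [-> ->] [-> ->] [-> ->].
move: (m 0 0) (m 0 1) (m 1 0) (m 1 1); rewrite !mxE e1 e2 e3 e4 f1 f2 f3 f4.
move=> [h1 h2] [h3 h4] [h5 h6] [h7 h8]; case/eqP: qq'.
by rewrite /quad_opp h1 h2 h3 h4 h5 h6 h7 h8 !opprK.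
Qed.

Lemma card_stab_octahedron (R : realType) :
  (stab_octahedron R #= `I_12)%card.
Proof.
have -> : stab_octahedron R = [set` map quad_PSL stab_quads].
  apply/seteqP; split=> k.
    by move/stabE/ocenter_stabP => [q qs ->]; apply/mapP; exists q.
  by move/mapP=> [q qs ->]; apply/stabE/ocenter_stabP; exists q.
have -> : [set` map quad_PSL stab_quads] = [set` [fset x in map quad_PSL stab_quads]%fset].
  by apply/seteqP; split=> x /=; rewrite in_fset.
by apply/card_eq_fsetP; rewrite card_fseq undup_id ?quad_PSL_uniq.
Qed.

(** Among 13 powers, two are equal. *)
Lemma ocenter_stab_torsion k : gact k ocenter = ocenter ->
  exists2 m, (0 < m)%N & (k ^+ m = 1)%g.
Proof.
move=> kC; pose s := [seq (k ^+ i)%g | i <- iota 0 13].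
have ks i : gact (k ^+ i)%g ocenter = ocenter.
  by elim: i => [|i IH]; rewrite ?expg0 ?gact1 // expgS gactM IH.
have /(uniqPn 1%g) [i [j [ij]]] : ~~ uniq s.
  apply/negP => us; have /(uniq_leq_size us) : {subset s <= map quad_PSL stab_quads}.
    move=> _ /mapP[i _ ->]; have /ocenter_stabP[q qs ->] := ks i.
    by apply/mapP; exists q.
  by rewrite size_map size_iota.
rewrite size_map size_iota => j13.
rewrite !(nth_map 0%N) ?size_iota ?(ltn_trans ij) // !nth_iota ?(ltn_trans ij) // !add0n => e.
exists (j - i)%N; first by rewrite subn_gt0.
by apply: (mulgI (k ^+ i)%g); rewrite -expgnDr mulg1 subnKC // ltnW.
Qed.

(** * Two counting arguments *)

Lemma cardfsX (T U : choiceType) (A : {fset T}) (B : {fset U}) :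
  #|` (A `*` B)%fset| = (#|` A| * #|` B|)%N.
Proof.
rewrite -(size_allpairs pair); apply: perm_size; apply: uniq_perm => //.
  by apply: allpairs_uniq => // -[? ?] [? ?] _ _ [-> ->].
move=> [x y]; rewrite in_fsetM /=; apply/andP/allpairsP => [[xA yB]|]; first by exists (x, y).
by case=> -[? ?] /= [? ? [-> ->]].
Qed.

Section DoubleCosets.
Variables (G : groupType) (H K : set G).
Local Open Scope group_scope.

Definition dcoset (x : G) : set G := [set y | exists h k, [/\ H h, K k & y = h * x * k]].
Definition rcos (x : G) : set G := [set h * x | h in H].

Hypotheses (H_subgroup : is_subgroup H) (K_subgroup : is_subgroup K).

Lemma dcoset_refl x : dcoset x x.
Proof.
have [H1 _ _] := H_subgroup; have [K1 _ _] := K_subgroup.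
by exists 1, 1; split=> //; rewrite mul1g mulg1.
Qed.

Lemma dcoset_eq x y : dcoset x y -> dcoset y = dcoset x.
Proof.
have [H1 HM HV] := H_subgroup; have [K1 KM KV] := K_subgroup.
move=> [h [k [Hh Kk ->]]]; apply/seteqP; split=> _ [h' [k' [Hh' Kk' ->]]].
  by exists (h' * h), (k * k'); split; rewrite ?mulgA //; [apply: HM|apply: KM].
exists (h' * h^-1), (k^-1 * k'); split; [by apply: HM; [|apply: HV]|by apply: KM; [apply: KV|]|].
by rewrite !mulgA mulgVK mulgK.
Qed.

Lemma rcos_eq x y : H (x * y^-1) -> rcos x = rcos y.
Proof.
have [H1 HM HV] := H_subgroup.
move=> Hxy; apply/seteqP; split=> _ [h Hh <-].
  by exists (h * (x * y^-1)); [apply: HM | rewrite !mulgA mulgVK].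
exists (h * (x * y^-1)^-1); first by apply: HM; [|apply: HV].
by rewrite invgM invgK !mulgA mulgVK.
Qed.

Lemma rcos_eqP x y : rcos x = rcos y -> H (x * y^-1).
Proof.
have [H1 HM HV] := H_subgroup => e.
have : rcos x x by exists 1; rewrite ?mul1g.
by rewrite e => -[h Hh <-]; rewrite mulgK.
Qed.

(** Choosing a representative in each double coset identifies pairs (double
    coset, element of K) with cosets of H: injectivity is the freeness of the
    action of H on the cosets of K. *)
Lemma card_double_cosets m n :
    (forall x k, K k -> H (x * k * x^-1) -> k = 1) ->
    K #= `I_m -> cosets H #= `I_n ->
  (m %| n)%N /\ double_cosets H K #= `I_(n %/ m).
Proof.
move=> free Km Hn; have [H1 HM HV] := H_subgroup; have [K1 KM KV] := K_subgroup.
pose rep (D : set G) := xget 1 [set x | D = dcoset x].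
have repE D : double_cosets H K D -> D = dcoset (rep D).
  by case=> x _ xD; apply: (@xgetPex _ 1 [set x | D = dcoset x]); exists x.
have bij : set_bij (double_cosets H K `*` K) (cosets H) (fun Dk => rcos (rep Dk.1 * Dk.2)).
  split.
  - by move=> [D k] _ /=; exists (rep D * k).
  - move=> [D k] [D' k'] /set_mem [/= dD Kk] /set_mem [/= dD' Kk'] /rcos_eqP /= Hx.
    have eD : D = D'.
      rewrite (repE D dD) (repE D' dD'); apply/esym/dcoset_eq.
      exists (rep D' * k' * (rep D * k)^-1), (k * k'^-1); split.
      - by have := HV _ Hx; rewrite invgM invgK.
      - by apply: KM => //; apply: KV.
      - by rewrite invgM !mulgA mulgVK mulgVK mulgK.
    move: Hx; rewrite eD invgM !mulgA -[rep D' * k * _]mulgA => /free.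
    move=> /(_ (KM _ _ Kk (KV _ Kk'))) kk; congr (_, _).
    by rewrite -[k](mulgVK k') kk mul1g.
  - move=> _ [x _ <-].
    have dx : double_cosets H K (dcoset x) by exists x.
    have := dcoset_refl x; rewrite {1}(repE _ dx) => -[h [k [Hh Kk ex]]].
    exists (dcoset x, k) => //=; apply: rcos_eq; rewrite {2}ex !invgM !mulgA mulgK mulgV mul1g.
    exact: HV.
have DKn : double_cosets H K `*` K #= `I_n.
  by apply: card_eq_trans Hn; apply/card_set_bijP; exists (fun Dk => rcos (rep Dk.1 * Dk.2)).
have finD : finite_set (double_cosets H K).
  have -> : double_cosets H K = fst @` (double_cosets H K `*` K).
    by apply/seteqP; split=> [D dD|_ [[D k] [/= dD _] <-] //]; exists (D, 1).
  by apply: finite_image; apply/finite_setP; exists n.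
have finK : finite_set K by apply/finite_setP; exists m.
have [N DN] := (finite_setP _).1 finD.
have nNm : n = (N * m)%N.
  by rewrite -(card_fset_set DKn) fset_setX // cardfsX (card_fset_set DN) (card_fset_set Km).
have m0 : (0 < m)%N.
  rewrite lt0n; apply/eqP => m0; move: Km; rewrite m0 II0 card_eq0 => /eqP K0.
  by have := K1; rewrite K0.
by rewrite nNm dvdn_mull // mulnK.
Qed.
End DoubleCosets.

(** A fixed-point-free involution has twice as many points as orbits; choosing
    one point in each orbit gives the set B. *)
Lemma card_pairs (T : pointedType) (A : set T) (i : T -> T) m :
    A #= `I_m -> (forall x, A x -> A (i x)) -> (forall x, A x -> i x <> x) ->
    (forall x, A x -> i (i x) = x) ->
  exists k, [/\ m = k.*2, [set [set x; i x] | x in A] #= `I_k &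
    exists B, [/\ B `<=` A, B #= `I_k & forall x, A x -> B x \/ B (i x)]].
Proof.
move=> Am iA i_neq iK.
pose pr x : set T := [set x; i x].
have pri x : A x -> pr (i x) = pr x.
  by move=> Ax; rewrite /pr iK // setUC.
have getpr x : get (pr x) = x \/ get (pr x) = i x.
  by have : pr x (get (pr x)) by apply: getPex; exists x; left.
pose B := [set x | A x /\ get (pr x) = x].
have BA : B `<=` A by move=> x [].
have finA : finite_set A by apply/finite_setP; exists m.
have finB : finite_set B by apply: sub_finite_set finA.
have [k Bk] := (finite_setP _).1 finB.
have AB x : A x -> B x \/ B (i x).
  move=> Ax; case: (getpr x) => e; [by left|right].
  by split; [exact: iA | rewrite pri].
have prB : [set pr x | x in A] = pr @` B.
  apply/seteqP; split=> [_ [x Ax <-]|_ [x [Ax _] <-]]; last by exists x.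
  by case: (AB x Ax) => Bx; [exists x | exists (i x); rewrite ?pri].
exists k; split; last by exists B.
  have iBinj : {in B &, injective i}.
    by move=> x y /set_mem[Ax _] /set_mem[Ay _] e; rewrite -[x]iK // e iK.
  have -> : m = #|`fset_set A| by rewrite (card_fset_set Am).
  have -> : A = B `|` i @` B.
    apply/seteqP; split=> [x Ax|x [/BA //|[y /BA Ay <-]]]; last exact: iA.
    by case: (AB x Ax) => Bx; [left | right; exists (i x); rewrite ?iK].
  rewrite fset_setU //; last exact: finite_image.
  rewrite cardfsU (_ : (_ `&` _)%fset = fset0) ?cardfs0 ?subn0.
    rewrite fset_set_image // card_in_imfset /=; last first.
      move=> x y; rewrite !in_fset_set // => xB yB; exact: iBinj.
    by rewrite (card_fset_set Bk) addnn.
  apply/fsetP => x; rewrite !inE !in_fset_set //; last exact: finite_image.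
  apply/negbTE/negP => /andP[/set_mem[Ax gx] /set_mem[y [Ay gy] yx]].
  move: gx; rewrite -yx pri // gy => yiy; exact: (i_neq y Ay).
rewrite prB; apply: card_eq_trans Bk; rewrite card_eq_sym; apply/card_set_bijP; exists pr.
split; [by move=> x Bx; exists x | | exact: subset_refl].
by move=> x y /set_mem[_ ex] /set_mem[_ ey] e; rewrite -ex e ey.
Qed.

(** * Connectedness of the tessellation through faces *)

(** Two vectors in the same half of the light cone. *)
Lemma hdot_pos (T : realFieldType) (u v : herm T) : hpos u -> hpos v -> 0 < hdot u v.
Proof.
move=> [du nu] [dv nv].
rewrite -(pmulr_rgt0 _ (mulr_gt0 du dv)).
have -> : hde u * hde v * hdot u v = hde v ^+ 2 * (hdot u u / 2) + hde u ^+ 2 * (hdot v v / 2)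
   + (hx u * hde v - hx v * hde u) ^+ 2 + (hy u * hde v - hy v * hde u) ^+ 2.
  by rewrite /hdot; field.
have := mulr_gt0 (exprn_gt0 2 dv) nu; have := mulr_gt0 (exprn_gt0 2 du) nv.
have := sqr_ge0 (hx u * hde v - hx v * hde u).
have := sqr_ge0 (hy u * hde v - hy v * hde u); lra.
Qed.

Lemma gact_ocenter_dot_gt0 g : 0 < hdot (gact g ocenter) ocenter.
Proof.
(* Over the rationals, where the identity behind [hdot_pos] can be divided by 2. *)
have o0 : hpos (hmap (intr : int -> rat) ocenter) by split; rewrite ?hdot_hmap ltr0z.
have := hdot_pos (hact_pos (repr g) o0) o0.
by rewrite -/(gact g _) gact_hmap hdot_hmap ltr0z.
Qed.

Section Tessellation.
Variable R : realType.
Local Notation ambient := (ambient R).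
Local Notation uhs := (@upper_half_space R).
Implicit Types (g h k : PSL2Zi) (b : face_index) (Q F : set ambient).

Definition tile g : set ambient := translate g (octahedron R).

Lemma tileM g h : tile (g * h)%g = translate g (tile h).
Proof. by rewrite /tile translateM //; exact: oct_uhs. Qed.

Lemma tile_uhs g : tile g `<=` uhs.
Proof. by apply: translate_uhs; exact: oct_uhs. Qed.

Lemma tile_farey g : farey_octahedra (tile g).
Proof. by exists g. Qed.

Lemma tile1 : tile 1%g = octahedron R.
Proof. by rewrite /tile translate1 //; exact: oct_uhs. Qed.

(** A tile property is propagated through faces.  The descent is done for all
    starting tiles x at once: if gC violates the wall b of O, then xO and its
    neighbour through b are adjacent, and the remaining element
    [(crossing b)^-1 * g] has a smaller product (gC, C). *)
Lemma tile_ind (S : set (set ambient)) g0 : S (tile g0) ->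
  (forall g b, S (tile g) -> S (@neighbour R g b)) -> forall g, S (tile g).
Proof.
move=> S0 Sn.
(* The bound n is the induction parameter; x is the tile from which g is followed. *)
suff R_all n g : (hdot (gact g ocenter) ocenter <= n%:Z) ->
    forall x, S (tile x) -> S (tile (x * g)%g).
  move=> g; rewrite -[g](mulVKg g0).
  apply: (R_all `|hdot (gact (g0^-1 * g)%g ocenter) ocenter|%N) => //.
  by rewrite gez0_abs // ltW // gact_ocenter_dot_gt0.
elim: n g => [|n IH] g gn x Sx.
  by have := lt_le_trans (gact_ocenter_dot_gt0 g) gn.
have [go|/existsNP[b /negP]] := pselect (in_oct (gact g ocenter)).
  rewrite (_ : tile (x * g)%g = tile x) //.
  by apply/tile_eqE; rewrite gactM gact_ocenter_oct.
rewrite hmap_int -ltNge => bneg.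
have := IH ((crossing b)^-1 * g)%g _ (x * crossing b)%g (Sn x b Sx).
rewrite mulgA mulgK; apply.
set u : int := hdot _ _ in gn; set v : int := hdot _ _ in bneg.
suff -> : hdot (gact ((crossing b)^-1 * g)%g ocenter) ocenter = u + 2 * v :> int by lia.
rewrite gactM gact_dotV invgK crossing_ocenter hdotC hdotDl hdotZl.
by rewrite ![hdot _ (gact g _)]hdotC.
Qed.

Lemma faces_translate h Q F : faces Q F -> faces (translate h Q) (translate h F).
Proof.
move=> [g [F0 [-> F0b ->]]]; exists (h * g)%g, F0; split=> //.
  by rewrite translateM //; exact: oct_uhs.
by rewrite translateM //; have [b ->] := (base_facesE F0).1 F0b; exact: region_uhs.
Qed.

Lemma faces_farey Q F : faces Q F -> farey_octahedra Q.
Proof. by move=> [g [F0 [-> _ _]]]; exists g. Qed.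

Lemma faces_two Q F : faces Q F -> exists Q', [/\ Q' <> Q, faces Q' F &
  forall Q'', faces Q'' F -> Q'' = Q \/ Q'' = Q'].
Proof.
move=> fQ; have [g _ gQ] := faces_farey fQ; move: fQ; rewrite -gQ.
move=> /facesE[b ->]; have [n1 n2 n3] := @neighbourP R g b.
by exists (@neighbour R g b).
Qed.

Lemma faces_uhs Q F : faces Q F -> F `<=` uhs.
Proof.
move=> [g [F0 [_ F0b ->]]]; apply: translate_uhs.
by have [b ->] := (base_facesE F0).1 F0b; exact: region_uhs.
Qed.

Lemma farey_uhs Q : farey_octahedra Q -> Q `<=` uhs.
Proof. by move=> [g _ <-]; exact: tile_uhs. Qed.

Lemma faces_sub Q F : faces Q F -> F `<=` Q.
Proof.
move=> [g [F0 [-> F0b ->]]] _ [p pF <-]; exists p => //; move: pF.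
by have [b ->] := (base_facesE F0).1 F0b; rewrite octahedronE => -[? []].
Qed.

Lemma faces_neq0 Q F : faces Q F -> F !=set0.
Proof.
move=> [g [F0 [_ F0b ->]]]; have [b ->] := (base_facesE F0).1 F0b.
have ne : in_face b (hmap intr (edge12 b) : herm R).
  by apply/in_face_toR; have [] := edge_in_face b.
have [|p p0 e] := @emb_surj _ (hmap intr (edge12 b) : herm R).
  by split; rewrite ?hdot_hmap ltr0z; case: (b) => [[[] []] []].
exists (act g p), p => //; split=> //.
have d0 : 0 < hde (hmap intr (edge12 b) : herm R).
  by rewrite ltr0z; case: (b) => [[[] []] []].
have := conic_face (b := b) (v := hmap intr (edge12 b))
  (k := (hde (hmap intr (edge12 b) : herm R))^-1).
rewrite invr_gt0 d0 => /(_ isT ne); rewrite e hscaleA hdeZ mulr1 mulVf ?gt_eqF //.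
by rewrite /hscale !mul1r; case: (emb p).
Qed.

Lemma faces_bound Q : farey_octahedra Q ->
  exists2 E : {fset set ambient}, faces Q `<=` [set` E] & (#|` E| <= 8)%N.
Proof.
move=> [g _ <-]; exists [fset translate g (@face R b) | b in face_index]%fset.
  by move=> F /facesE[b ->]; apply/imfsetP; exists b.
apply: leq_trans (leq_imfset_card _ _ _) _.
by rewrite -cardT /face_index /= !card_prod card_bool.
Qed.

Lemma interior_farey_eq h Q Q' : farey_octahedra Q -> farey_octahedra Q' ->
  interior Q = translate h (interior Q') <-> Q = translate h Q'.
Proof.
move=> [g _ <-] [g' _ <-]; rewrite -/(tile g) -/(tile g') -interior_translate; last exact: tile_uhs.
rewrite -tileM; split=> [|-> //]; exact: tile_interior_inj.
Qed.
End Tessellation.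

(** * Fundamental domains made of tiles *)

Section Domains.
Variables (R : realType) (H : set PSL2Zi) (n : nat).
Hypotheses (H_subgroup : is_subgroup H) (H_torsion_free : torsion_free H)
    (H_index : has_index H n).
Local Notation ambient := (ambient R).
Local Notation uhs := (@upper_half_space R).
Local Notation farey := (@farey_octahedra R).
Local Notation stab := (stab_octahedron R).
Local Notation DC := (double_cosets H stab).
Implicit Types (g h s : PSL2Zi) (b : face_index) (Q F : set ambient)
  (P : set (set ambient)).

Let H1 : H 1%g. Proof. by case: H_subgroup. Qed.
Let HM x y : H x -> H y -> H (x * y)%g. Proof. by case: H_subgroup => _ + _; apply. Qed.
Let HV x : H x -> H x^-1%g. Proof. by case: H_subgroup => _ _; apply. Qed.

Lemma stab_subgroup : is_subgroup stab.
Proof.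
split=> [|x y /stabE ex /stabE ey|x /stabE ex]; apply/stabE.
- exact: gact1.
- by rewrite gactM ey.
- exact: gactV_ocenter.
Qed.

(** An element that stabilizes a tile is conjugate into the stabilizer of the
    octahedron, hence is torsion. *)
Lemma farey_free h Q : H h -> farey Q -> translate h Q = Q -> h = 1%g.
Proof.
move=> Hh [g _ <-]; rewrite -/(@tile R g) -tileM => /tile_eqE.
rewrite gactM => /(congr1 (gact g^-1%g)).
rewrite gactK -!gactM ?mulgA => /ocenter_stab_torsion[m m0 e].
apply: (H_torsion_free Hh m0).
have conj_exp j : ((g^-1 * h * g) ^+ j = g^-1 * (h ^+ j * g))%g.
  by elim: j => [|j IH]; rewrite ?expg0 ?mul1g ?mulVg // !expgS IH !mulgA mulgK.
move: e; rewrite conj_exp => /(congr1 (fun x => g * x)%g); rewrite mulVKg mulg1 => e.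
by apply: (mulIg g); rewrite e mul1g.
Qed.

Lemma index_double_cosets : (12 %| n)%N /\ DC #= `I_(n %/ 12).
Proof.
apply: (card_double_cosets H_subgroup stab_subgroup _ (card_stab_octahedron R) H_index).
move=> x k /stabE kC Hk; apply: (mulgI x); rewrite mulg1; apply: (mulIg x^-1%g).
rewrite mulgV; apply: (farey_free Hk (@tile_farey R x)).
by rewrite -/(@tile R x) -tileM mulgVK; apply/tile_eqE; rewrite gactM kC.
Qed.

(** The elements that carry the octahedron into the orbit of a tile: the double
    coset that corresponds to this orbit. *)
Definition movers Q : set PSL2Zi := [set x | exists2 h, H h & @tile R x = translate h Q].

Lemma movers_tile g : movers (@tile R g) = dcoset H stab g.
Proof.
apply/seteqP; split => x.
  move=> [h Hh]; rewrite -tileM => /tile_eqE e; exists h, ((h * g)^-1 * x)%g; split=> //.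
    by apply/stabE; rewrite gactM e gactK.
  by rewrite mulVKg.
move=> [h [k [Hh /stabE kC ->]]]; exists h => //; rewrite -tileM.
by apply/tile_eqE; rewrite !gactM kC.
Qed.

(** With [covers], this splits the representation of the orbits into uniqueness
    and existence, and drops the interiors; the growth of a domain maintains the
    former until the latter holds. *)
Definition independent P :=
  P `<=` farey /\ forall Q Q' h, P Q -> P Q' -> H h -> Q = translate h Q' -> Q = Q'.

Definition covers P := forall Q, farey Q -> exists Q' h, [/\ P Q', H h & Q = translate h Q'].

Lemma translate1_farey Q : farey Q -> translate 1%g Q = Q.
Proof. by move=> /farey_uhs; exact: translate1. Qed.

Lemma represents_orbits_onceE P :
  represents_orbits_once H P <-> independent P /\ covers P.
Proof.
split=> [[Pf ex]|[[Pf ind] cov]]; split=> //.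
- split=> // Q Q' h PQ PQ' Hh QQ'; have [Q0 [_ u]] := ex Q (Pf _ PQ).
  have <- : Q0 = Q.
    apply: u; split=> //; exists 1%g => //.
    by apply/(interior_farey_eq _ (Pf _ PQ) (Pf _ PQ)); rewrite translate1_farey //; exact: Pf.
  apply: u; split=> //; exists h => //.
  exact/(interior_farey_eq _ (Pf _ PQ) (Pf _ PQ')).
- move=> Q fQ; have [Q' [[PQ' [h Hh e]] _]] := ex Q fQ.
  by exists Q', h; split=> //; exact/(interior_farey_eq _ fQ (Pf _ PQ')).
- move=> Q fQ; have [Q' [h [PQ' Hh e]]] := cov Q fQ.
  exists Q'; split.
    by split=> //; exists h => //; exact/(interior_farey_eq _ fQ (Pf _ PQ')).
  move=> Q'' [PQ'' [h' Hh' /(interior_farey_eq _ fQ (Pf _ PQ'')) e']].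
  apply: (ind _ _ (h^-1 * h')%g) => //.
    by apply: HM => //; exact: HV.
  rewrite translateM; last exact/farey_uhs/Pf.
  by rewrite -e' e translateK //; exact/farey_uhs/Pf.
Qed.

Lemma independent_inj P : independent P -> {in P &, injective movers}.
Proof.
move=> [Pf ind] Q Q' /set_mem PQ /set_mem PQ'.
have [g _ gQ] := Pf _ PQ => e.
have : movers Q g by exists 1%g => //; rewrite translate1_farey //; exact: Pf.
by rewrite e => -[h Hh]; rewrite /tile gQ; exact: ind.
Qed.

Lemma movers_DC P : P `<=` farey -> set_fun P DC movers.
Proof. by move=> Pf Q /Pf [g _ <-]; exists g => //; rewrite -/(@tile R g) movers_tile. Qed.

Lemma independent_card P : independent P -> P #<= `I_(n %/ 12).
Proof.
move=> indP; have [_ DCn] := index_double_cosets.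
rewrite -(card_le_eqr DCn) -(card_le_eql (inj_card_eq (independent_inj indP))).
by apply: subset_card_le => _ [Q PQ <-]; apply: movers_DC PQ; case: indP.
Qed.

Lemma orbit_reps_card P : represents_orbits_once H P -> P #= `I_(n %/ 12).
Proof.
move=> /represents_orbits_onceE [indP cov]; have [_ DCn] := index_double_cosets.
have [Pf _] := indP.
apply: card_eq_trans DCn; apply/card_set_bijP; exists movers; split.
- exact: movers_DC.
- exact: independent_inj.
move=> _ [x _ <-]; have [Q [h [PQ Hh xQ]]] := cov _ (@tile_farey R x).
exists Q => //; have -> : Q = @tile R (h^-1 * x)%g.
  by rewrite tileM [@tile R x]xQ translateK //; exact/farey_uhs/Pf.
rewrite movers_tile; apply: (dcoset_eq H_subgroup stab_subgroup).
by exists h^-1%g, 1%g; split; rewrite ?mulg1 //; [exact: HV | case: stab_subgroup].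
Qed.

Definition reached P : set (set ambient) :=
  [set Q | exists Q' h, [/\ P Q', H h & Q = translate h Q']].

Lemma reached_translate P h Q : P `<=` farey -> H h -> reached P Q -> reached P (translate h Q).
Proof.
move=> Pf Hh [Q' [h' [PQ' Hh' ->]]]; exists Q', (h * h')%g; split=> //; first exact: HM.
by rewrite translateM //; exact/farey_uhs/Pf.
Qed.

Lemma subset_reached P : P `<=` farey -> P `<=` reached P.
Proof. by move=> Pf Q PQ; exists Q, 1%g; split=> //; rewrite translate1_farey //; exact: Pf. Qed.

(** If the tiles H-equivalent to P are closed under adjacency, they are all the
    tiles; otherwise an adjacency that leaves them can be moved by H to start in
    P. *)
Lemma covers_or_boundary P : P `<=` farey -> P !=set0 -> covers P \/
  exists g b, P (tile g) /\ ~ reached P (neighbour g b).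
Proof.
move=> Pf [Q0 PQ0]; have [cl|/existsNP[g /existsNP[b /not_implyP[[Q' [h [PQ' Hh gQ]]] nr]]]] :=
    pselect (forall g b, reached P (tile g) -> reached P (neighbour g b)).
  left=> Q [g _ <-]; have [g0 _ gQ0] := Pf _ PQ0.
  suff : reached P (@tile R g) by [].
  by apply: (tile_ind (g0 := g0)) => //; rewrite /tile gQ0; exact: subset_reached.
right; have gQ' : tile (h^-1 * g)%g = Q'.
  by rewrite tileM gQ translateK //; exact/farey_uhs/Pf.
exists (h^-1 * g)%g, b; split; first by rewrite gQ'.
move=> /(reached_translate Pf Hh); rewrite /neighbour -!/(tile _) -tileM.
by rewrite !mulgA mulgV mul1g.
Qed.

(** The invariant of the growth.  An upper bound on the exposed faces is enough,
    since the induction only needs the face being glued to be one of them. *)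
Definition grown k P := [/\ independent P, P #= `I_k, connected (\bigcup_(Q in P) Q) &
  exists2 E : {fset set ambient}, exposed_faces P `<=` [set` E] & (#|` E| <= 6 * k + 2)%N].

Lemma grown_one : grown 1 [set octahedron R].
Proof.
have fo : farey (octahedron R) by exists 1%g => //; exact: tile1.
split.
- by split=> [_ -> //|Q Q' h -> -> //].
- by rewrite -(set_fset1 (octahedron R)); apply/card_eq_fsetP; rewrite cardfs1.
- by rewrite bigcup_set1; exact: oct_connected.
have [E fE E8] := faces_bound fo; exists E => // F [[Q -> QF] _]; exact: fE.
Qed.

(** The new tile Q' meets a tile Q of P in a face F.  The face F was exposed, as Q'
    is the only other tile through it, and is exposed no more. *)
Lemma grow k P : (0 < k)%N -> grown k P -> covers P \/ exists P', grown k.+1 P'.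
Proof.
move=> k0 [indP Pk Pc [E PE Ek]]; have [Pf ind] := indP.
have P0 : P !=set0.
  apply/set0P/eqP => P0; move: Pk; rewrite P0 card_eq_sym card_eq0 => /eqP e.
  by have : `I_k 0%N by []; rewrite e.
have [|[g [b [Pg nr]]]] := covers_or_boundary Pf P0; [by left|right].
set Q := tile g in Pg; set Q' := neighbour g b in nr.
have fQ' : farey Q' by exact: tile_farey.
have nPQ' : ~ P Q' by move/(subset_reached Pf).
pose F := translate g (@face R b).
have [QQ' Q'F two] : [/\ Q' <> Q, faces Q' F & forall Q'', faces Q'' F -> Q'' = Q \/ Q'' = Q'].
  exact: neighbourP.
have QF : faces Q F by apply/facesE; exists b.
exists (Q' |` P); split.
- split=> [Q1 [-> //|/Pf //]|Q1 Q2 h [->|PQ1] [->|PQ2] // Hh e].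
  + by case: nr; exists Q2, h.
  + case: nr; exists Q1, h^-1%g; split=> //; first exact: HV.
    by rewrite e translateK //; exact: farey_uhs.
  + exact: ind e.
- have finP : finite_set P by apply/finite_setP; exists k.
  rewrite -[P]fset_setK // -set_fsetU1; apply/card_eq_fsetP.
  by rewrite cardfsU1 (card_fset_set Pk) in_fset_set // memNset.
- rewrite bigcup_setU1; apply: connectedU => //; last exact: tile_connected.
  have [p Fp] := faces_neq0 QF; exists p; split; first exact: (faces_sub Q'F).
  by exists Q => //; exact: (faces_sub QF).
have [E8 fE8 E88] := faces_bound fQ'.
exists ((E `\ F) `|` (E8 `\ F))%fset.
  move=> F1 [[Q1 PQ1 Q1F1] ns].
  have F1F : F1 <> F.
    by move=> F1F; apply: ns; exists Q', Q; split; rewrite ?F1F //; [left|right].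
  rewrite /= !inE; apply/orP; case: PQ1 => [Q1Q'|PQ1].
    by right; apply/andP; split; [exact/eqP | apply: fE8; rewrite -Q1Q'].
  left; apply/andP; split; first exact/eqP.
  apply: PE; split; first by exists Q1.
  move=> [Q2 [Q3 [PQ2 PQ3 Q23 F2 F3]]]; apply: ns; exists Q2, Q3.
  by split=> //; right.
have FE : F \in E.
  apply: PE; split; first by exists Q.
  move=> [Q2 [Q3 [PQ2 PQ3 Q23 /two[] e2 /two[] e3]]]; subst => //.
have FE8 : F \in E8 by exact: fE8.
apply: leq_trans (leq_card_fsetU _ _) _.
(* One face less on each side of the gluing: 6k + 2 - 1 + 8 - 1 = 6(k + 1) + 2. *)
move: Ek E88; rewrite (cardfsD1 F E) (cardfsD1 F E8) FE FE8; lia.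
Qed.

(** The growth stops because independent sets have at most n / 12 tiles. *)
Lemma fundamental_domain_exists :
  exists P, grown (n %/ 12) P /\ represents_orbits_once H P.
Proof.
pose N := (n %/ 12)%N.
have small k P : grown k P -> (k <= N)%N.
  by move=> [indP Pk _ _]; have := independent_card indP; rewrite (card_le_eql Pk) card_le_II.
suff all_k k : (exists P, grown k.+1 P) \/ exists j P, grown j P /\ covers P.
  have [[P /small]|[j [P [gP cP]]]] := all_k N; first by rewrite ltnn.
  have oP : represents_orbits_once H P by apply/represents_orbits_onceE; case: gP.
  exists P; split=> //; have [_ Pj _ _] := gP.
  have /card_eq_II <- : `I_j #= `I_(n %/ 12) by rewrite -(card_eql Pj) orbit_reps_card.
  by [].
elim: k => [|k [[P gP]|]]; [by left; exists [set octahedron R]; exact: grown_one| |by right].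
by have [cP|] := grow (ltn0Sn k) gP; [right; exists k.+1, P | left].
Qed.

Section SidePairings.
Variable P : set (set ambient).
Hypotheses (P_independent : independent P) (P_covers : covers P).

Let Pf : P `<=` farey. Proof. by case: P_independent. Qed.

Lemma exposed_unique F Q Q' : exposed_faces P F -> P Q -> P Q' ->
  faces Q F -> faces Q' F -> Q = Q'.
Proof.
move=> [_ ns] PQ PQ' QF Q'F; apply: contrapT => QQ'.
by apply: ns; exists Q, Q'.
Qed.

Lemma side_pairing_in F s : side_pairing H P F s -> H s.
Proof. by move=> [_ [h [Q0 [Q [Hh _ _ _ ->]]]]]; exact: HV. Qed.

Lemma side_pairing_exists F : exposed_faces P F -> exists s, side_pairing H P F s.
Proof.
move=> exF; have [[Q0 PQ0 Q0F] ns] := exF.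
have [Q' [Q'Q0 Q'F _]] := faces_two Q0F.
have [Q [h [PQ Hh e]]] := P_covers (faces_farey Q'F).
by exists h^-1%g; split=> //; exists h, Q0, Q; split; rewrite -?e.
Qed.

(** The tile on the other side is determined by the face, its representative in
    P by independence, and the transformation by freeness. *)
Lemma side_pairing_unique F s s' :
  side_pairing H P F s -> side_pairing H P F s' -> s = s'.
Proof.
move=> [exF [h [Q0 [Q [Hh [PQ0 Q0F] [PQ hQF] hQ0 ->]]]]].
move=> [_ [h' [Q0' [Q' [Hh' [PQ0' Q0'F] [PQ' hQF'] hQ0' ->]]]]].
have e0 : Q0' = Q0 by exact: exposed_unique exF PQ0' PQ0 Q0'F Q0F.
rewrite {}e0 in hQ0' Q0'F PQ0'.
have [Q1 [_ _ two]] := faces_two Q0F.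
have hh : translate h Q = translate h' Q'.
  by case: (two _ hQF) (two _ hQF') => [//|->] [//|->].
have hQ : Q = translate (h^-1 * h')%g Q'.
  rewrite translateM; last exact/farey_uhs/Pf.
  by rewrite -hh translateK //; exact/farey_uhs/Pf.
have Hh1 : H (h^-1 * h')%g by apply: HM => //; exact: HV.
have [_ ind] := P_independent; have QQ' := ind _ _ _ PQ PQ' Hh1 hQ.
rewrite -QQ' in hQ; have := farey_free Hh1 (Pf PQ) (esym hQ).
by move/mulg1_eq; rewrite invgK => ->.
Qed.

(** A transformation in H that fixes a face permutes the two tiles through it, so
    its square stabilizes a tile and is trivial; torsion-freeness makes it trivial
    itself, and then the face would be shared. *)
Lemma side_pairing_neq F s : side_pairing H P F s -> translate s F <> F.
Proof.
move=> [exF [h [Q0 [Q [Hh [PQ0 Q0F] [PQ hQF] hQ0 ->]]]]] e.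
have [_ ns] := exF.
have [Q1 [Q1Q0 Q1F two]] := faces_two Q0F.
have Hh1 : H h^-1%g by exact: HV.
have f0 := faces_farey Q0F; have f1 := faces_farey Q1F.
set r := h^-1%g in e Hh1.
have sF Q2 : faces Q2 F -> faces (translate r Q2) F by move/(faces_translate r); rewrite e.
have fixed Q2 : farey Q2 -> translate (r * r)%g Q2 = Q2 -> r = 1%g.
  move=> f2 e2; have := farey_free (HM Hh1 Hh1) f2 e2 => ss.
  by apply: (H_torsion_free (k := 2) Hh1) => //; rewrite expgS expg1.
have s1 : r = 1%g.
  apply: (fixed Q0 f0); rewrite translateM; last exact: farey_uhs.
  case: (two _ (sF _ Q0F)) => e0; first by rewrite !e0.
  rewrite e0; case: (two _ (sF _ Q1F)) => // e1.
  have : translate r Q0 = translate r Q1 by rewrite e0 e1.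
  move/(congr1 (translate r^-1%g)); rewrite !translateK => [/esym //||]; exact: farey_uhs.
have h1 : h = 1%g by rewrite -[h]invgK -/r s1 invg1.
rewrite h1 translate1_farey in hQF hQ0; last exact: Pf.
by apply: ns; exists Q, Q0.
Qed.

(** If the opposite face were shared, the tile on its other side would be both in
    P and H-equivalent to the tile of P adjacent to F, hence equal to it; the
    transformation would be trivial and F shared. *)
Lemma side_pairing_inv F s : side_pairing H P F s ->
  side_pairing H P (translate s F) s^-1%g.
Proof.
move=> [exF [h [Q0 [Q [Hh [PQ0 Q0F] [PQ hQF] hQ0 ->]]]]]; rewrite invgK.
have Hh1 : H h^-1%g by exact: HV.
have QF : faces Q (translate h^-1%g F).
  by have := faces_translate h^-1%g hQF; rewrite translateK //; exact/farey_uhs/Pf.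
have Q0F' : faces (translate h^-1%g Q0) (translate h^-1%g F) by exact: faces_translate.
have neQ : translate h^-1%g Q0 <> Q.
  move=> e; apply: hQ0; rewrite -e translateVK //; exact/farey_uhs/Pf.
split; last by exists h^-1%g, Q, Q0; split=> //; rewrite invgK.
split; first by exists Q.
move=> [Q1 [Q2 [PQ1 PQ2 Q12 Q1F Q2F]]].
have [Q3 [_ _ two]] := faces_two QF.
have e3 : translate h^-1%g Q0 = Q3 by case: (two _ Q0F').
have PQ3 : P Q3.
  by case: (two _ Q1F) (two _ Q2F) => e1 [] e2; subst.
have [_ ind] := P_independent.
have Q30 : Q3 = Q0 by apply: (ind _ _ h^-1%g).
have hV1 : h^-1%g = 1%g by apply: (farey_free Hh1 (Pf PQ0)); rewrite e3.
have h1 : h = 1%g by rewrite -[h]invgK hV1 invg1.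
have [_ ns] := exF; apply: ns; rewrite h1 translate1_farey in hQF hQ0; last exact: Pf.
by exists Q, Q0.
Qed.

(** The tiles lQ, with Q in P and l in L, are closed under adjacency: the neighbour
    of Q through a face is in P if this face is shared, and sent into P by a side
    pairing if it is exposed.  So they are all the tiles, and an element h of H is
    recognized by the image of one tile of P. *)
Lemma side_pairings_generate L : P !=set0 -> is_subgroup L ->
  side_pairings H P `<=` L -> H `<=` L.
Proof.
move=> [Q0 PQ0] [L1 LM LV] sL.
pose S : set (set ambient) := [set Q | exists Q' l, [/\ P Q', H l, L l & Q = translate l Q']].
have [g0 _ gQ0] := Pf PQ0.
have Sn g b : S (tile g) -> S (neighbour g b).
  move=> [Q1 [l [PQ1 Hl Ll gl]]].
  have [nne nF two] := @neighbourP R g b; set F := translate g _ in nF two.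
  have Q1E : Q1 = translate l^-1%g (tile g) by rewrite gl translateK //; exact/farey_uhs/Pf.
  pose F1 := translate l^-1%g F; pose Q2 : set ambient := translate l^-1%g (neighbour g b).
  have nE : neighbour g b = translate l Q2.
    by rewrite /Q2 translateVK //; exact/farey_uhs/tile_farey.
  have Q1F : faces Q1 F1 by rewrite Q1E; apply/faces_translate/facesE; exists b.
  have Q2F : faces Q2 F1 by exact: faces_translate.
  have Q21 : Q2 <> Q1.
    by move=> e; apply: nne; rewrite nE e -gl.
  have [Q3 [Q31 Q3F two1]] := faces_two Q1F.
  have Q23 : Q2 = Q3 by case: (two1 _ Q2F).
  have [[Q4 [Q5 [PQ4 PQ5 Q45 Q4F Q5F]]]|ns] := pselect (shared_face P F1).
    have PQ2 : P Q2.
      by case: (two1 _ Q4F) (two1 _ Q5F) => e4 [] e5; rewrite Q23; subst.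
    by exists Q2, l.
  have exF : exposed_faces P F1 by split=> //; exists Q1.
  have [s sp] := side_pairing_exists exF.
  have [_ [h [Q4 [Q5 [Hh [PQ4 Q4F] [PQ5 hQ5F] hQ5 sE]]]]] := sp.
  have Q41 : Q4 = Q1 by exact: exposed_unique exF PQ4 PQ1 Q4F Q1F.
  have Q52 : translate h Q5 = Q2.
    by rewrite Q23; case: (two1 _ hQ5F) => // e; case: hQ5; rewrite e Q41.
  exists Q5, (l * h)%g; split=> //; first exact: HM.
    apply: LM => //; rewrite -[h]invgK -sE; apply: LV; apply: sL; exists F1; exact: sp.
  by rewrite translateM ?Q52 //; exact/farey_uhs/Pf.
have S0 : S (tile g0).
  by exists Q0, 1%g; split=> //; rewrite translate1_farey //; exact: Pf.
move=> h Hh; have [Q1 [l [PQ1 Hl Ll e]]] := tile_ind S0 Sn (h * g0)%g.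
have hQ0 : translate h Q0 = translate l Q1 by rewrite -e tileM -gQ0.
have lhQ : Q1 = translate (l^-1 * h)%g Q0.
  rewrite translateM; last exact/farey_uhs/Pf.
  by rewrite hQ0 translateK //; exact/farey_uhs/Pf.
have Hlh : H (l^-1 * h)%g by apply: HM => //; exact: HV.
have [_ ind] := P_independent; have Q10 := ind _ _ _ PQ1 PQ0 Hlh lhQ.
rewrite Q10 in lhQ; have := farey_free Hlh (Pf PQ0) (esym lhQ).
by move/mulg1_eq; rewrite invgK => <-.
Qed.
End SidePairings.
End Domains.

Theorem theoremB (R : realType) (H : set PSL2Zi) (n : nat)
    (H_subgroup : is_subgroup H) (H_torsion_free : torsion_free H)
    (H_index : has_index H n) :
  let N := (n %/ 12)%N in
  [/\ (12 %| n)%N,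
      double_cosets H (stab_octahedron R) #= `I_N,
      (forall P : set (set (ambient R)), represents_orbits_once H P -> P #= `I_N) &
      exists P : set (set (ambient R)),
      [/\ farey_fundamental_domain H P,
          P #= `I_N,
          (exists2 m : nat, exposed_faces P #= `I_m & (m <= 6 * N + 2)%N),
          (* the exposed faces occur in distinct H-paired pairs *)
          (forall F, exposed_faces P F -> exists! s, side_pairing H P F s) /\
          (forall F s, side_pairing H P F s ->
             translate s F <> F /\
             side_pairing H P (translate s F) (s^-1)%g) &
          (* one transformation, up to inversion, for each pair *)
          (3 * N + 1 = n %/ 4 + 1)%N /\
          (exists2 k : nat, face_pairs H P #= `I_k & (k <= 3 * N + 1)%N) /\
          exists S : set PSL2Zi,
          [/\ (forall s, side_pairings H P s <-> S s \/ S (s^-1)%g),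
              S #<= `I_(3 * N + 1) &
              generated S = H]]].
Proof.
move=> N; have [n12 DCN] := index_double_cosets R H_subgroup H_torsion_free H_index.
have cardN := orbit_reps_card H_subgroup H_torsion_free H_index.
split=> //; first exact: cardN.
have [P [[indP PN Pc [E PE EN]] oP]] :=
  fundamental_domain_exists R H_subgroup H_torsion_free H_index.
have [_ covP] := (represents_orbits_onceE H_subgroup P).1 oP.
have finex : finite_set (exposed_faces P).
  by apply: sub_finite_set PE _; exact: finite_fset.
have [m exm] := (finite_setP _).1 finex.
have mN : (m <= 6 * N + 2)%N.
  apply: leq_trans EN; rewrite -(card_fset_set exm); apply: fsubset_leq_card.
  by apply/fsubsetP => F; rewrite in_fset_set // => /set_mem /PE.
have P0 : P !=set0.
  by have [Q [h [PQ _ _]]] := covP _ (@tile_farey R 1%g); exists Q.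
have unique := side_pairing_unique H_subgroup H_torsion_free indP.
have neq := side_pairing_neq H_subgroup H_torsion_free indP.
have inv := side_pairing_inv H_subgroup H_torsion_free indP.
pose pairing F := xget 1%g [set s | side_pairing H P F s].
have pairingP F : exposed_faces P F -> side_pairing H P F (pairing F).
  move=> /(side_pairing_exists covP)[s sp].
  by apply: (@xgetPex _ 1%g [set s | side_pairing H P F s]); exists s.
have pairingE F s : side_pairing H P F s -> pairing F = s.
  by move=> sp; apply: (unique F) => //; apply: pairingP; case: sp.
pose opposite F := translate (pairing F) F.
have ex_opp F : exposed_faces P F -> exposed_faces P (opposite F).
  by move=> /pairingP /inv [].
have opp_neq F : exposed_faces P F -> opposite F <> F by move=> /pairingP /neq.
have opp_pairing F : exposed_faces P F -> pairing (opposite F) = (pairing F)^-1%g.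
  by move=> /pairingP /inv /pairingE.
have oppK F : exposed_faces P F -> opposite (opposite F) = F.
  move=> exF; rewrite {1}/opposite opp_pairing // translateK //.
  by have [[Q _ QF] _] := exF; exact: faces_uhs QF.
have [k [mk pk [B [BE Bk EB]]]] := card_pairs exm ex_opp opp_neq oppK.
have kN : (k <= 3 * N + 1)%N by lia.
exists P; split=> //.
- by split=> //; apply/finite_setP; exists N.
- by exists m.
- split=> [F /pairingP sp|F s sp]; last by split; [exact: neq sp|exact: inv].
  by exists (pairing F); split=> // s; exact: unique.
split; first by lia.
split.
  exists k => //.
  suff <- : [set [set F; opposite F] | F in exposed_faces P] = face_pairs H P by [].
  apply/seteqP; split=> [_ [F exF <-]|_ [F [s [sp ->]]]].
    by exists F, (pairing F); split=> //; exact: pairingP.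
  by exists F; [case: sp | rewrite /opposite (pairingE _ _ sp)].
have sides s : side_pairings H P s <-> (pairing @` B) s \/ (pairing @` B) (s^-1)%g.
  split=> [[F sp]|[[F /BE exF <-]|[F /BE exF e]]].
  - have exF : exposed_faces P F by case: sp.
    case: (EB F exF) => BF; [left; exists F => //; exact: pairingE|right].
    by exists (opposite F); rewrite // opp_pairing // (pairingE _ _ sp).
  - by exists F; exact: pairingP.
  - exists (opposite F); have := inv _ _ (pairingP _ exF); rewrite e invgK.
    by rewrite /opposite e.
exists (pairing @` B); split=> //.
  apply: card_le_trans (card_image_le _ _) _.
  by rewrite (card_le_eql Bk) card_le_II.
apply/seteqP; split.
  move=> x; apply; first exact: H_subgroup.
  by move=> _ [F /BE /pairingP sp <-]; exact: side_pairing_in sp.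
move=> h Hh L L_subgroup BL; apply: (side_pairings_generate _ _ indP covP) Hh => //.
have [L1 LM LV] := L_subgroup.
move=> s /sides [/BL //|/BL Ls]; rewrite -[s]invgK; exact: LV.
Qed.
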